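(* Let $\mathbf{k}=\mathbb{Z}/2$ and let $A$ be a symmetric DG open Frobenius $\mathbf{k}$-algebra. Then $HH_*(A,A)$ (after a degree shift making the product below of degree $0$) is naturally equipped with a BV-algebra structure whose BV-operator is the Connes operator $B$ and whose product, at chain level and before the shift, is given by $$a_0[a_1,\dots,a_n]\circ b_0[b_1,\dots,b_q]=\begin{cases}0,&\text{if }n>0,\\ \sum_{(a_0)}a_0''a_0'b_0[b_1,\dots,b_q],&\text{otherwise.}\end{cases}$$
   Context: Everything is over $\mathbf{k}=\mathbb{Z}/2$, so signs are omitted. **Open Frobenius algebras.** A DG open Frobenius algebra of degree $m$ is a triple $(A,\cdot,\delta)$ where $(A,\cdot)$ is a unital (augmented) DG associative algebra with product of degree $0$, $\delta:A\to A\otimes A$, $\delta x=\sum_{(x)}x'\otimes x''$, is a coassociative chain map of degree $m$, and $\delta$ is a map of left and right $A$-modules: $\sum(xy)'\otimes(xy)''=\sum xy'\otimes y''=\sum x'\otimes x''y$. It is symmetric if $\sum_{(1)}1'\otimes1''=\sum_{(1)}1''\otimes1'$. **Hochschild homology.** $\bar A=A/\mathbf{k}$, $s\bar A$ is $\bar A$ with degrees lowered by one, $C_*(A,A)=A\otimes T(s\bar A)$ is the normalized Hochschild chain complex, whose elements are sums of $a_0[a_1,\dots,a_n]$, with homology $HH_*(A,A)$. The Connes operator is $B(a_0[a_1,\dots,a_n])=\sum_{i=1}^{n+1}1[a_i,\dots,a_n,a_0,\dots,a_{i-1}]$. **BV-algebra.** A graded commutative associative algebra (not required to be unital) with an operator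 $\Delta$ of degree $\pm1$ (depending on grading conventions) such that $\Delta^2=0$ and $\Delta(abc)=\Delta(ab)c+a\Delta(bc)+b\Delta(ac)+\Delta(a)bc+a\Delta(b)c+ab\Delta(c)$. *)

(* Defs.v *)
From HB Require Import structures.
From mathcomp Require Import all_boot all_order all_algebra finmap.
From mathcomp Require Import boolp.
From mathcomp Require Import monalg.

Set Implicit Arguments.
Unset Strict Implicit.
Unset Printing Implicit Defensive.

Import GRing.Theory.
Local Open Scope ring_scope.
Local Open Scope quotient_scope.

Section Span.
Variables (K : fieldType) (V : lmodType K).

Definition span_of (E : V -> Prop) : {pred V} := fun x =>
  `[< exists n (c : 'I_n -> K) (v : 'I_n -> V),
        (forall i, E (v i)) /\ x = \sum_(i < n) c i *: v i >].

Lemma span_of_submod (E : V -> Prop) : submod_closed (span_of E).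
Proof.
split.
  apply/asboolP; exists 0%N, (fun=> 0), (fun=> 0).
  by split=> [[]|]//; rewrite big_ord0.
move=> a x y /asboolP[n [c [v [Ev ->]]]] /asboolP[p [b [w [Ew ->]]]].
apply/asboolP; exists (n + p)%N.
exists (fun i => match split i with inl j => a * c j | inr j => b j end).
exists (fun i => match split i with inl j => v j | inr j => w j end).
split=> [i|]; first by case: (split i).
rewrite big_split_ord /= scaler_sumr; congr (_ + _); apply: eq_bigr => i _.
  by rewrite (unsplitK (inl i)) scalerA.
by rewrite (unsplitK (inr i)).
Qed.

Lemma mem_span_of (E : V -> Prop) x : E x -> x \in span_of E.
Proof.
move=> Ex; apply/asboolP; exists 1%N, (fun=> 1), (fun=> x); split=> //.
by rewrite big_ord1 scale1r.
Qed.

End Span.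

Section QuotientModule.
Variables (K : fieldType) (V : lmodType K) (S : {pred V}).
Hypothesis Ssub : submod_closed S.

Definition sub_pred of submod_closed S : {pred V} := S.
HB.instance Definition _ :=
  GRing.isSubmodClosed.Build K V (sub_pred Ssub) Ssub.

Definition lquot := Quotient.quot (sub_pred Ssub).
HB.instance Definition _ := GRing.Zmodule.on lquot.

Definition lquot_pi (x : V) : lquot := \pi_lquot x.

Lemma lquot_eq0 x : (lquot_pi x == 0) = (x \in S).
Proof.
have <- : lquot_pi 0 = 0 by rewrite /lquot_pi; exact: raddf0.
by rewrite /lquot_pi -Quotient.idealrBE subr0.
Qed.

Lemma lquot_pi_is_zmod_morphism : zmod_morphism lquot_pi.
Proof. exact: raddfB. Qed.

Definition lquot_scale (a : K) (x : lquot) : lquot := lquot_pi (a *: repr x).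

Lemma lquot_scale_pi a x : lquot_scale a (lquot_pi x) = lquot_pi (a *: x).
Proof.
apply/eqP; rewrite -subr_eq0 -lquot_pi_is_zmod_morphism lquot_eq0 -scalerBr.
have : repr (lquot_pi x) - x \in S.
  by rewrite -lquot_eq0 lquot_pi_is_zmod_morphism /lquot_pi reprK subrr.
by move=> Sx; rewrite -[X in X \in _]addr0 Ssub.2 ?Ssub.1.
Qed.

Lemma lquot_piD x y : lquot_pi (x + y) = lquot_pi x + lquot_pi y.
Proof. exact: raddfD. Qed.

Lemma lquot_ind (P : lquot -> Prop) : (forall x, P (lquot_pi x)) -> forall x, P x.
Proof. by move=> PP x; rewrite -[x]reprK; apply: PP. Qed.

Lemma lquot_scaleA a b x : lquot_scale a (lquot_scale b x) = lquot_scale (a * b) x.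
Proof. by elim/lquot_ind: x => x; rewrite !lquot_scale_pi scalerA. Qed.
Lemma lquot_scale1 : left_id 1 lquot_scale.
Proof. by elim/lquot_ind=> x; rewrite !lquot_scale_pi scale1r. Qed.
Lemma lquot_scaleDr : right_distributive lquot_scale +%R.
Proof.
move=> a; elim/lquot_ind=> x; elim/lquot_ind=> y.
by rewrite -lquot_piD !lquot_scale_pi scalerDr lquot_piD.
Qed.
Lemma lquot_scaleDl x : {morph lquot_scale^~ x : a b / a + b}.
Proof.
by move=> a b; elim/lquot_ind: x => x; rewrite !lquot_scale_pi scalerDl lquot_piD.
Qed.

HB.instance Definition _ := GRing.Zmodule_isLmodule.Build K lquot
  lquot_scaleA lquot_scale1 lquot_scaleDr lquot_scaleDl.

Lemma lquot_pi_is_linear : linear lquot_pi.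
Proof.
by move=> a x y; rewrite lquot_piD -lquot_scale_pi.
Qed.
HB.instance Definition _ :=
  GRing.isLinear.Build K V lquot *:%R lquot_pi lquot_pi_is_linear.

End QuotientModule.

Record quotient_data (K : fieldType) (V : lmodType K) (S : {pred V}) := {
  quotient_mod : lmodType K;
  quotient_map : {linear V -> quotient_mod};
  quotient_map_surj : forall y, exists x, quotient_map x = y;
  quotient_map_eq0 : forall x, (quotient_map x == 0) = (x \in S)
}.

(* Opaque on purpose: V / S is only used through its projection, which is
   surjective with kernel S. *)
Lemma quotient_exists (K : fieldType) (V : lmodType K) (S : {pred V}) :
  submod_closed S -> quotient_data S.
Proof.
move=> Ssub; exists (lquot Ssub : lmodType K) (lquot_pi Ssub : {linear V -> _}).
  by elim/lquot_ind=> x; exists x.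
exact: lquot_eq0.
Qed.

Section Quotient.
Variables (K : fieldType) (V : lmodType K) (S : {pred V}).
Variable Ssub : submod_closed S.
Definition quotient : lmodType K := quotient_mod (quotient_exists Ssub).
Definition quot_class : {linear V -> quotient} :=
  quotient_map (quotient_exists Ssub).

Lemma quot_class_surj (y : quotient) : exists x, quot_class x = y.
Proof. exact: quotient_map_surj. Qed.

Lemma quot_class_eq0 x : (quot_class x == 0) = (x \in S).
Proof. exact: quotient_map_eq0. Qed.

Lemma quot_class_eq x y : (quot_class x == quot_class y) = (x - y \in S).
Proof. by rewrite -subr_eq0 -linearB quot_class_eq0. Qed.
End Quotient.

Section FreeLift.
Variables (K : fieldType) (X : choiceType) (W : lmodType K) (f : X -> W).

Definition free_lift (g : {malg K[X]}) : W := \sum_(x <- msupp g) g@_x *: f x.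

Lemma free_liftEw (D : {fset X}) g : (msupp g `<=` D)%fset ->
  free_lift g = \sum_(x <- D) g@_x *: f x.
Proof.
move=> gD; rewrite /free_lift (big_fset_incl _ gD) // => x _ xg.
by rewrite mcoeff_outdom // scale0r.
Qed.

Lemma free_lift_is_linear : linear free_lift.
Proof.
move=> a g h; pose D := (msupp g `|` msupp h)%fset.
have gD : (msupp g `<=` D)%fset by apply: fsubsetUl.
have hD : (msupp h `<=` D)%fset by apply: fsubsetUr.
rewrite (free_liftEw gD) (free_liftEw hD) (@free_liftEw D); last first.
  apply: fsubset_trans (msuppD_le _ _) _; rewrite fsubUset hD andbT.
  exact: fsubset_trans (msuppZ_le _ _) gD.
rewrite scaler_sumr -big_split /=; apply: eq_bigr => x _.
by rewrite mcoeffD mcoeffZ scalerDl scalerA.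
Qed.
HB.instance Definition _ :=
  GRing.isLinear.Build K _ W *:%R free_lift free_lift_is_linear.

Lemma free_liftU x : free_lift << x >> = f x.
Proof.
by rewrite (@free_liftEw [fset x]%fset) ?msuppU_le // big_seq_fset1 mcoeffUU
   scale1r.
Qed.
End FreeLift.

(* The K-module generated by X subject to the relations r = 0, for r in rel. *)
Definition presented (K : fieldType) (X : choiceType)
    (rel : {malg K[X]} -> Prop) : lmodType K := quotient (span_of_submod rel).

(* Locked for performance. *)
HB.lock Definition pgen (K : fieldType) (X : choiceType)
    (rel : {malg K[X]} -> Prop) (x : X) : presented rel :=
  quot_class (span_of_submod rel) << x >>.

Section Presentation.
Variables (K : fieldType) (X : choiceType) (rel : {malg K[X]} -> Prop).
Local Notation presented := (presented rel).
Local Notation pgen := (pgen rel).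

Lemma presented_span (u : presented) :
  exists (s : seq X) (c : X -> K), u = \sum_(x <- s) c x *: pgen x.
Proof.
have [v <-] := quot_class_surj u; exists (msupp v), (fun x => v@_x).
rewrite {1}[v]monalgE linear_sum; apply: eq_bigr => x _.
rewrite pgen.unlock -linearZ /=; congr (quot_class _ _).
by apply/malgP => y; rewrite mcoeffZ !mcoeffU mulr_natr.
Qed.

Lemma presented_eq (W : lmodType K) (f g : {linear presented -> W}) :
  (forall x, f (pgen x) = g (pgen x)) -> f =1 g.
Proof.
move=> fg u; have [s [c ->]] := presented_span u.
by rewrite !linear_sum; apply: eq_bigr => x _; rewrite !linearZ /= fg.
Qed.

Lemma presented_rel r : rel r -> quot_class (span_of_submod rel) r = 0.
Proof. by move=> rr; apply/eqP; rewrite quot_class_eq0 mem_span_of. Qed.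

Lemma plift_exists (W : lmodType K) (f : X -> W) :
  (forall r, rel r -> free_lift f r = 0) ->
  {h : {linear presented -> W} | forall x, h (pgen x) = f x}.
Proof.
move=> f_rel.
have [h hE] : {h : presented -> W |
    forall v, h (quot_class (span_of_submod rel) v) = free_lift f v}.
  exists (fun u => free_lift f (sval (cid (quot_class_surj u)))) => v.
  case: (cid _) => w /= /eqP; rewrite quot_class_eq.
  move=> /asboolP[n [c [e [Ee wv]]]]; apply/eqP; rewrite -subr_eq0 -linearB wv.
  by rewrite linear_sum big1 // => i _; rewrite linearZ /= f_rel // scaler0.
have h_lin : linear h.
  move=> a u v; have [x <-] := quot_class_surj u; have [y <-] := quot_class_surj v.
  by rewrite -linearP !hE linearP.
pose hL := GRing.isLinear.Build K presented W *:%R h h_lin.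
pose H : {linear presented -> W} := HB.pack h hL.
by exists H => x; rewrite /= pgen.unlock hE free_liftU.
Qed.

Definition plift (W : lmodType K) (f : X -> W)
    (f_rel : forall r, rel r -> free_lift f r = 0) : presented -> W :=
  sval (plift_exists f_rel).
HB.instance Definition _ (W : lmodType K) (f : X -> W)
    (f_rel : forall r, rel r -> free_lift f r = 0) :=
  GRing.Linear.copy (plift f_rel) (sval (plift_exists f_rel)).

Lemma plift_gen (W : lmodType K) (f : X -> W)
    (f_rel : forall r, rel r -> free_lift f r = 0) x :
  plift f_rel (pgen x) = f x.
Proof. exact: (svalP (plift_exists f_rel)). Qed.

End Presentation.

Definition bilin (K : fieldType) (U V W : lmodType K) (f : U -> V -> W) :=
  (forall v, linear (f^~ v)) /\ (forall u, linear (f u)).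

Section Tensor.
Variables (K : fieldType) (U V : lmodType K).

Inductive tensor_rel : {malg K[(U * V)%type]} -> Prop :=
| TensorL a u u' v :
    tensor_rel (<< (a *: u + u', v) >> - (a *: << (u, v) >> + << (u', v) >>))
| TensorR a u v v' :
    tensor_rel (<< (u, a *: v + v') >> - (a *: << (u, v) >> + << (u, v') >>)).

Definition tensor : lmodType K := presented tensor_rel.

Definition pure (u : U) (v : V) : tensor := pgen tensor_rel (u, v).

Lemma pureDl a u u' v : pure (a *: u + u') v = a *: pure u v + pure u' v.
Proof.
apply/eqP; rewrite -subr_eq0 /pure pgen.unlock -linearP -linearB.
exact/eqP/presented_rel/TensorL.
Qed.

Lemma pureDr a u v v' : pure u (a *: v + v') = a *: pure u v + pure u v'.
Proof.
apply/eqP; rewrite -subr_eq0 /pure pgen.unlock -linearP -linearB.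
exact/eqP/presented_rel/TensorR.
Qed.

Lemma tlift_rel (W : lmodType K) (f : U -> V -> W) : bilin f ->
  forall r, tensor_rel r -> free_lift (fun p : U * V => f p.1 p.2) r = 0.
Proof.
move=> [fl fr] r; case=> [a u u' v|a u v v'];
  rewrite linearB linearP /= !free_liftU /=; apply/eqP; rewrite subr_eq0; apply/eqP.
  exact: fl.
exact: fr.
Qed.

Definition tlift (W : lmodType K) (f : U -> V -> W) (fbilin : bilin f) :
  tensor -> W := plift (tlift_rel fbilin).
HB.instance Definition _ (W : lmodType K) (f : U -> V -> W) (fbilin : bilin f) :=
  GRing.Linear.copy (tlift fbilin) (plift (tlift_rel fbilin)).

Lemma tlift_pure (W : lmodType K) (f : U -> V -> W) (fbilin : bilin f) u v :
  tlift fbilin (pure u v) = f u v.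
Proof. exact: plift_gen. Qed.

Lemma tensor_eq (W : lmodType K) (f g : {linear tensor -> W}) :
  (forall u v, f (pure u v) = g (pure u v)) -> f =1 g.
Proof. by move=> fg; apply: presented_eq => -[u v]; apply: fg. Qed.

End Tensor.

Notation "U \ox V" := (tensor U V) (at level 40, left associativity) : type_scope.
Notation "u *t v" := (pure u v) (at level 40, left associativity) : ring_scope.

Section TensorMaps.
Variable K : fieldType.

Lemma tmap_bilin (U U' V V' : lmodType K)
    (f : {linear U -> U'}) (g : {linear V -> V'}) :
  bilin (fun u v => f u *t g v).
Proof. by split=> [v a u u'|u a v v']; rewrite linearP ?pureDl ?pureDr. Qed.

Definition tmap (U U' V V' : lmodType K)
    (f : {linear U -> U'}) (g : {linear V -> V'}) : U \ox V -> U' \ox V' :=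
  tlift (tmap_bilin f g).

Section Assoc.
Variables (U V W : lmodType K).

Lemma tassoc_pure_bilin (w : W) : bilin (fun (u : U) (v : V) => u *t (v *t w)).
Proof. by split=> [v a u u'|u a v v']; rewrite pureDl ?pureDr. Qed.

Lemma tassoc_bilin :
  bilin (fun (t : U \ox V) (w : W) => tlift (tassoc_pure_bilin w) t).
Proof.
split=> [w a t t'|t a w w']; first exact: linearP.
pose h : {linear U \ox V -> U \ox (V \ox W)} :=
  a \*: tlift (tassoc_pure_bilin w) \+ tlift (tassoc_pure_bilin w').
suff : tlift (tassoc_pure_bilin (a *: w + w')) =1 h by move/(_ t).
by apply: tensor_eq => u v; rewrite /= !tlift_pure !pureDr.
Qed.

Definition tassoc : (U \ox V) \ox W -> U \ox (V \ox W) :=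
  tlift tassoc_bilin.
End Assoc.

Lemma tswap_bilin (U V : lmodType K) : bilin (fun (u : U) (v : V) => v *t u).
Proof. by split=> [v a u u'|u a v v']; rewrite ?pureDl ?pureDr. Qed.

Definition tswap (U V : lmodType K) : U \ox V -> V \ox U :=
  tlift (@tswap_bilin U V).

End TensorMaps.

Definition is_grading (K : fieldType) (V : lmodType K) (G : int -> {pred V}) :=
  [/\ forall k, submod_closed (G k),
      forall x, exists (s : seq int) (f : int -> V),
        (forall k, f k \in G k) /\ x = \sum_(k <- s) f k
    & forall (s : seq int) (f : int -> V), uniq s -> (forall k, f k \in G k) ->
        \sum_(k <- s) f k = 0 -> {in s, forall k, f k = 0}].

Definition tensor_gr (K : fieldType) (U V : lmodType K)
    (G : int -> {pred U}) (H : int -> {pred V}) (k : int) : {pred U \ox V} :=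
  span_of (fun t => exists p q u v,
    [/\ p + q = k, u \in G p, v \in H q & t = u *t v]).

(* Augmented DG algebras. The shift s lowers degrees by one, so differentials
   have degree +1. All Koszul signs are trivial over Z/2. *)
Record dgAlgebra := DGAlgebra {
  dga_alg :> algType 'F_2;
  dga_gr : int -> {pred dga_alg};
  dga_d : {linear dga_alg -> dga_alg};
  dga_aug : {lrmorphism dga_alg -> ('F_2)^o};
  dga_grP : is_grading dga_gr;
  dga_gr1 : 1 \in dga_gr 0;
  dga_grM : forall p q x y,
    x \in dga_gr p -> y \in dga_gr q -> x * y \in dga_gr (p + q);
  dga_grd : forall p x, x \in dga_gr p -> dga_d x \in dga_gr (p + 1);
  dga_dd : forall x, dga_d (dga_d x) = 0;
  dga_leibniz : forall x y, dga_d (x * y) = dga_d x * y + x * dga_d y;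
  dga_aug_gr : forall p x, p != 0 -> x \in dga_gr p -> dga_aug x = 0;
  dga_aug_d : forall x, dga_aug (dga_d x) = 0
}.

Arguments dga_gr : clear implicits.
Definition tensor_d (A : dgAlgebra) (t : A \ox A) : A \ox A :=
  tmap (dga_d A) idfun t + tmap idfun (dga_d A) t.

(* The two module-map axioms read (xy)' (x) (xy)'' = xy' (x) y'' and
   (xy)' (x) (xy)'' = x' (x) x''y. *)
Record openFrobenius (m : int) := OpenFrobenius {
  of_dga :> dgAlgebra;
  of_cop : {linear of_dga -> of_dga \ox of_dga};
  of_copgr : forall p x, x \in dga_gr of_dga p ->
    of_cop x \in tensor_gr (dga_gr of_dga) (dga_gr of_dga) (p + m);
  of_copd : forall x, of_cop (dga_d of_dga x) = tensor_d (of_cop x);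
  of_coassoc : forall x,
    tassoc (tmap of_cop idfun (of_cop x)) = tmap idfun of_cop (of_cop x);
  of_copMl : forall x y : of_dga,
    of_cop (x * y) = tmap (x \*o idfun) idfun (of_cop y);
  of_copMr : forall x y : of_dga,
    of_cop (x * y) = tmap idfun (y \o* idfun) (of_cop x)
}.

Definition symmetric_frobenius (m : int) (A : openFrobenius m) :=
  tswap (of_cop A 1) = of_cop A 1.

Section HochschildModule.
Variable A : algType 'F_2.

(* A (x) T(s(A/k)) presented by the generators a0[a1,...,an], encoded as the
   pairs (a0, [:: a1; ...; an]): multilinearity in all slots, and vanishing
   when some ai with i >= 1 is the unit (normalization). *)
Inductive hoch_rel : {malg 'F_2[(A * seq A)%type]} -> Prop :=
| HochHead c a a' s : hoch_rel
    (<< (c *: a + a', s) >> - (c *: << (a, s) >> + << (a', s) >>))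
| HochSlot a s1 s2 c x y : hoch_rel
    (<< (a, s1 ++ (c *: x + y) :: s2) >>
       - (c *: << (a, s1 ++ x :: s2) >> + << (a, s1 ++ y :: s2) >>))
| HochUnit a s1 s2 : hoch_rel << (a, s1 ++ 1 :: s2) >>.

Definition hoch : lmodType 'F_2 := presented hoch_rel.
Definition word (a : A) (s : seq A) : hoch := pgen hoch_rel (a, s).

Definition multilin (W : lmodType 'F_2) (f : A -> seq A -> W) :=
  [/\ forall s, linear (f^~ s),
      forall a s1 s2, linear (fun x => f a (s1 ++ x :: s2))
    & forall a s1 s2, f a (s1 ++ 1 :: s2) = 0].

Lemma wordD0 s c a a' : word (c *: a + a') s = c *: word a s + word a' s.
Proof.
apply/eqP; rewrite -subr_eq0 /word pgen.unlock -linearP -linearB.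
exact/eqP/presented_rel/HochHead.
Qed.

Lemma wordD a s1 s2 c x y : word a (s1 ++ (c *: x + y) :: s2) =
  c *: word a (s1 ++ x :: s2) + word a (s1 ++ y :: s2).
Proof.
apply/eqP; rewrite -subr_eq0 /word pgen.unlock -linearP -linearB.
exact/eqP/presented_rel/HochSlot.
Qed.

Lemma word1 a s1 s2 : word a (s1 ++ 1 :: s2) = 0.
Proof. by rewrite /word pgen.unlock; apply/presented_rel/HochUnit. Qed.

Section Lift.
Variables (W : lmodType 'F_2) (f : A -> seq A -> W) (fml : multilin f).

Lemma hlift_rel r :
  hoch_rel r -> free_lift (fun p : A * seq A => f p.1 p.2) r = 0.
Proof.
case: fml => f0 f1 f2.
case=> [c a a' s|a s1 s2 c x y|a s1 s2]; last by rewrite free_liftU f2.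
  by rewrite linearB linearP /= !free_liftU /= f0 subrr.
by rewrite linearB linearP /= !free_liftU /= f1 subrr.
Qed.

Definition hlift : hoch -> W := plift hlift_rel.
HB.instance Definition _ := GRing.Linear.copy hlift (plift hlift_rel).

Lemma hlift_word a s : hlift (word a s) = f a s.
Proof. exact: plift_gen. Qed.
End Lift.

Lemma hoch_eq (W : lmodType 'F_2) (f g : {linear hoch -> W}) :
  (forall a s, f (word a s) = g (word a s)) -> f =1 g.
Proof. by move=> fg; apply: presented_eq => -[a s]; apply: fg. Qed.

End HochschildModule.

Lemma addrr_F2 (V : lmodType 'F_2) (v : V) : v + v = 0.
Proof.
rewrite -[v]scale1r -scalerDl -[RHS](scale0r v); congr (_ *: _).
exact/val_inj.
Qed.

Section SlotSums.
Variables (A : algType 'F_2) (W : lmodType 'F_2).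
Implicit Type g : seq A -> W.

Definition slot_linear g := forall s1 s2, linear (fun x => g (s1 ++ x :: s2)).
Definition slot_normal g := forall s1 s2, g (s1 ++ 1 :: s2) = 0.

Definition sum_apply (d : A -> A) g (s : seq A) : W :=
  \sum_(i < size s) g (take i s ++ d (nth 0 s i) :: drop i.+1 s).

Definition sum_merge g (s : seq A) : W :=
  \sum_(i < (size s).-1) g (take i s ++ nth 0 s i * nth 0 s i.+1 :: drop i.+2 s).

Lemma sum_apply_cons d g x s :
  sum_apply d g (x :: s) = g (d x :: s) + sum_apply d (g \o cons x) s.
Proof. by rewrite /sum_apply /= big_ord_recl /= drop0. Qed.

Lemma sum_merge_cons g x y s :
  sum_merge g [:: x, y & s] = g (x * y :: s) + sum_merge (g \o cons x) (y :: s).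
Proof. by rewrite /sum_merge /= big_ord_recl /= drop0. Qed.

Lemma slot_linear_cons g x : slot_linear g -> slot_linear (g \o cons x).
Proof. by move=> gl s1 s2; apply: (gl (x :: s1)). Qed.

Lemma slot_normal_cons g x : slot_normal g -> slot_normal (g \o cons x).
Proof. by move=> gl s1 s2; apply: (gl (x :: s1)). Qed.

Lemma add4 (c : 'F_2) (a b a' b' : W) :
  (c *: a + b) + (c *: a' + b') = c *: (a + a') + (b + b').
Proof. by rewrite scalerDr addrACA. Qed.

Lemma sum_apply_linear (d : {linear A -> A}) g :
  slot_linear g -> slot_linear (sum_apply d g).
Proof.
move=> gl s1; elim: s1 g gl => [|z s1 IH] g gl s2 c x y /=.
  rewrite !sum_apply_cons linearP (gl [::]) /= -add4; congr (_ + _).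
  rewrite /sum_apply scaler_sumr -big_split; apply: eq_bigr => i _ /=.
  exact: (gl [::]).
rewrite !sum_apply_cons (gl (d z :: s1)) /= -add4; congr (_ + _).
exact/IH/slot_linear_cons.
Qed.

Lemma sum_apply_normal (d : A -> A) g :
  (forall s1 s2, g (s1 ++ 0 :: s2) = 0) -> d 1 = 0 ->
  slot_normal g -> slot_normal (sum_apply d g).
Proof.
move=> g0 d1 gn s1; elim: s1 g g0 gn => [|z s1 IH] g g0 gn s2 /=.
  rewrite sum_apply_cons d1 (g0 [::]) add0r /sum_apply big1 // => i _ /=.
  exact: (gn [::]).
rewrite sum_apply_cons (gn (d z :: s1)) add0r; apply: IH.
  by move=> s3 s4; apply: (g0 (z :: s3)).
exact: slot_normal_cons.
Qed.

Lemma sum_merge_linear g : slot_linear g -> slot_linear (sum_merge g).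
Proof.
move=> gl s1; elim: s1 g gl => [|z s1 IH] g gl s2 c x y /=.
  case: s2 => [|w s2]; first by rewrite /sum_merge !big_ord0 scaler0 addr0.
  rewrite !sum_merge_cons mulrDl -scalerAl (gl [::]) /= -add4; congr (_ + _).
  rewrite /sum_merge scaler_sumr -big_split; apply: eq_bigr => i _ /=.
  exact: (gl [::]).
case: s1 IH => [|z' s1] IH /=.
  rewrite !sum_merge_cons mulrDr -scalerAr (gl [::]) /= -add4; congr (_ + _).
  exact/(IH (g \o cons z))/slot_linear_cons.
rewrite !sum_merge_cons (gl (z * z' :: s1)) /= -add4; congr (_ + _).
exact/(IH (g \o cons z))/slot_linear_cons.
Qed.

Lemma sum_merge_unit g s1 s2 : slot_normal g ->
  sum_merge g (s1 ++ 1 :: s2) =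
    (if s1 is [::] then 0 else g (s1 ++ s2)) +
    (if s2 is [::] then 0 else g (s1 ++ s2)).
Proof.
elim: s1 g => [|z s1 IH] g gn /=.
  case: s2 => [|w s2]; first by rewrite /sum_merge big_ord0 addr0.
  rewrite sum_merge_cons mul1r add0r /sum_merge big1 ?addr0 // => i _ /=.
  exact: (gn [::]).
case: s1 IH => [|z' s1] IH /=.
  rewrite sum_merge_cons mulr1 (IH (g \o cons z)) /= ?add0r //.
  exact: slot_normal_cons.
rewrite sum_merge_cons (gn (z * z' :: s1)) add0r (IH (g \o cons z)) //.
exact: slot_normal_cons.
Qed.

End SlotSums.

Section HochschildOperators.
Variable A : dgAlgebra.
Local Notation C := (hoch A).
Local Notation d := (dga_d A).

Lemma dga_d1 : d 1 = 0.
Proof.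
have := dga_leibniz (d := A) 1 1; rewrite !(mulr1, mul1r) => /(congr1 (+%R^~ (- d 1))).
by rewrite addrK subrr => <-.
Qed.

(* On a0[a1,...,an], the differential of A applied to each letter in turn, and
   the Hochschild boundary
   a0a1[a2,...] + sum_i a0[...,ai a(i+1),...] + an a0[a1,...,a(n-1)]. *)
Definition word_dint (a : A) (s : seq A) : C :=
  word (d a) s +
  \sum_(i < size s) word a (take i s ++ d (nth 0 s i) :: drop i.+1 s).

Definition word_dext (a : A) (s : seq A) : C :=
  if s is x :: s' then
    word (a * x) s'
    + \sum_(i < (size s).-1)
        word a (take i s ++ nth 0 s i * nth 0 s i.+1 :: drop i.+2 s)
    + word (last x s' * a) (belast x s')
  else 0.

(* The summand of index i is 1[a(i+1),...,an,a0,a1,...,ai]. *)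
Definition word_connes (a : A) (s : seq A) : C :=
  \sum_(i < (size s).+1) word 1 (drop i s ++ a :: take i s).

Lemma word_slot_linear a : slot_linear (@word A a).
Proof. by move=> s1 s2 c x y; apply: wordD. Qed.

Lemma word_slot_normal a : slot_normal (@word A a).
Proof. by move=> s1 s2; apply: word1. Qed.

Lemma word_slot0 a s1 s2 : word a (s1 ++ 0 :: s2) = 0 :> C.
Proof. by have := wordD a s1 s2 (-1) 0 0; rewrite !scaleN1r !addNr. Qed.

Lemma word_dint_multilin : multilin word_dint.
Proof.
split=> [s c a a'|a s1 s2 c x y|a s1 s2]; rewrite /word_dint.
- rewrite linearP wordD0 -add4; congr (_ + _).
  rewrite scaler_sumr -big_split; apply: eq_bigr => i _ /=.
  exact: wordD0.
- rewrite wordD -add4; congr (_ + _).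
  exact: (sum_apply_linear d (word_slot_linear a)).
rewrite word1 add0r; apply: (@sum_apply_normal _ _ d (word a)).
- exact: word_slot0.
- exact: dga_d1.
exact: word_slot_normal.
Qed.

Lemma word_dext_rcons a s x : word_dext a (rcons s x) =
  (if s is y :: s' then word (a * y) (rcons s' x) else word (a * x) [::])
  + sum_merge (word a) (rcons s x) + word (x * a) s.
Proof.
by case: s => [|y s] //=; rewrite last_rcons belast_rcons.
Qed.

Lemma word_dext_multilin : multilin word_dext.
Proof.
split=> [s c a a'|a s1 s2 c x y|a s1 s2].
- case: s => [|x s]; rewrite /word_dext; first by rewrite scaler0 addr0.
  rewrite mulrDl mulrDr -scalerAl -scalerAr !wordD0 -!add4; congr (_ + _ + _).
  rewrite scaler_sumr -big_split; apply: eq_bigr => i _ /=.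
  exact: wordD0.
- have mlin := sum_merge_linear (word_slot_linear a) s1 s2 c x y.
  case/lastP: s2 mlin => [|s2 z] mlin.
    rewrite !cats1 !word_dext_rcons -!cats1 mlin mulrDl -scalerAl wordD0 -!add4.
    congr (_ + _ + _); case: s1 {mlin} => [|w s1].
      by rewrite mulrDr -scalerAr wordD0.
    by rewrite /= -!cats1; apply: wordD.
  move: mlin; rewrite -!rcons_cons -!rcons_cat !word_dext_rcons => ->.
  rewrite wordD -!add4; congr (_ + _ + _); case: s1 => [|w s1] /=.
    by rewrite mulrDr -scalerAr wordD0.
  by rewrite !rcons_cat !rcons_cons; apply: wordD.
have mu := sum_merge_unit s1 s2 (word_slot_normal a).
case/lastP: s2 mu => [|s2 z] mu.
  rewrite cats1 word_dext_rcons -cats1 mu mul1r cats0.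
  case: s1 {mu} => [|w s1] /=.
    by rewrite !addr0 mulr1 addrr_F2.
  by rewrite -cats1 word1 add0r addr0 addrr_F2.
rewrite -rcons_cons -rcons_cat word_dext_rcons rcons_cat rcons_cons mu word1 addr0.
have -> : (if rcons s2 z is [::] then 0 else word a (s1 ++ rcons s2 z)) =
  word a (s1 ++ rcons s2 z) by case: s2 {mu}.
case: s1 {mu} => [|w s1] /=; first by rewrite add0r mulr1 addrr_F2.
by rewrite rcons_cat rcons_cons word1 add0r addrr_F2.
Qed.

Lemma rotate_slot a s1 s2 i : exists u v,
  forall x : A, drop i (s1 ++ x :: s2) ++ a :: take i (s1 ++ x :: s2) = u ++ x :: v.
Proof.
have [le_i|lt_i] := leqP i (size s1).
  exists (drop i s1), (s2 ++ a :: take i s1) => x.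
  rewrite drop_cat take_cat; case: ltngtP le_i => // [_|->] _.
    by rewrite -catA.
  by rewrite subnn take_size drop_size /= cats0.
exists (drop (i - size s1).-1 s2 ++ a :: s1), (take (i - size s1).-1 s2) => x.
rewrite drop_cat take_cat ltnNge (ltnW lt_i) /=.
by rewrite -subn_gt0 in lt_i; case: (_ - _)%N lt_i => //= j _; rewrite -catA.
Qed.

Lemma word_connes_multilin : multilin word_connes.
Proof.
split=> [s c a a'|a s1 s2 c x y|a s1 s2]; rewrite /word_connes.
- by rewrite scaler_sumr -big_split; apply: eq_bigr => i _; apply: wordD.
- rewrite !size_cat /= scaler_sumr -big_split; apply: eq_bigr => i _ /=.
  by have [u [v uv]] := rotate_slot a s1 s2 i; rewrite !uv; apply: wordD.
rewrite big1 // => i _.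
by have [u [v uv]] := rotate_slot a s1 s2 i; rewrite uv word1.
Qed.

Definition hoch_dint : C -> C := hlift word_dint_multilin.
HB.instance Definition _ :=
  GRing.Linear.copy hoch_dint (hlift word_dint_multilin).

Definition hoch_dext : C -> C := hlift word_dext_multilin.
HB.instance Definition _ :=
  GRing.Linear.copy hoch_dext (hlift word_dext_multilin).

Definition hoch_d (x : C) : C := hoch_dint x + hoch_dext x.

Lemma hoch_d_is_linear : linear hoch_d.
Proof. by move=> c x y; rewrite /hoch_d !linearP add4. Qed.
HB.instance Definition _ :=
  GRing.isLinear.Build 'F_2 C C *:%R hoch_d hoch_d_is_linear.

Definition connes : C -> C := hlift word_connes_multilin.
HB.instance Definition _ :=
  GRing.Linear.copy connes (hlift word_connes_multilin).

(* a0[a1,...,an] has degree |a0| + ... + |an| - n. *)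
Definition hoch_gr (k : int) : {pred C} :=
  span_of (fun x => exists p a (ps : seq int) (s : seq A),
    [/\ p + \sum_(q <- ps) (q - 1) = k, a \in dga_gr A p,
        all2 (fun q b => b \in dga_gr A q) ps s & x = word a s]).

Definition hoch_cycle : {pred C} := [pred x | hoch_d x == 0].

Lemma hoch_cycle_submod : submod_closed hoch_cycle.
Proof.
split; first by rewrite inE linear0.
by move=> c x y /eqP dx /eqP dy; rewrite inE linearP /= dx dy scaler0 addr0.
Qed.
HB.instance Definition _ :=
  GRing.isSubmodClosed.Build 'F_2 C hoch_cycle hoch_cycle_submod.

Definition cycles := {x : C | x \in hoch_cycle}.
HB.instance Definition _ := SubType.on cycles.
HB.instance Definition _ := [Choice of cycles by <:].
HB.instance Definition _ := [SubChoice_isSubLmodule of cycles by <:].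

Definition hoch_boundary : {pred cycles} :=
  fun z => `[< exists x : C, val z = hoch_d x >].

Lemma hoch_boundary_submod : submod_closed hoch_boundary.
Proof.
split; first by apply/asboolP; exists 0; rewrite linear0 raddf0.
move=> c z w /asboolP[x zx] /asboolP[y wy]; apply/asboolP.
exists (c *: x + y); rewrite hoch_d_is_linear -zx -wy.
exact: (linearP (val : cycles -> C)).
Qed.

Definition HH : lmodType 'F_2 := quotient hoch_boundary_submod.
Definition HHclass : {linear cycles -> HH} := quot_class hoch_boundary_submod.

Definition HH_gr (k : int) : {pred HH} :=
  fun h => `[< exists2 z : cycles, val z \in hoch_gr k & HHclass z = h >].

End HochschildOperators.
Arguments HH_gr : clear implicits.

Section HochschildProduct.
Variables (m : int) (A : openFrobenius m).
Local Notation C := (hoch A).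

Lemma mul_swap_bilin : bilin (fun u v : A => v * u).
Proof.
split=> [v c u u'|u c v v']; first by rewrite mulrDr scalerAr.
by rewrite mulrDl scalerAl.
Qed.

(* a |-> \sum a'' a' *)
Definition handle (a : A) : A := tlift mul_swap_bilin (of_cop A a).

Lemma handle_is_linear : linear handle.
Proof. by move=> c x y; rewrite /handle !linearP. Qed.

Lemma word_lmul_multilin (z : A) : multilin (fun b s => word (z * b) s).
Proof.
split=> [s c b b'|b s1 s2 c x y|b s1 s2].
- by rewrite mulrDr -scalerAr wordD0.
- exact: wordD.
exact: word1.
Qed.

Definition hoch_lmul (z : A) : C -> C := hlift (word_lmul_multilin z).
HB.instance Definition _ (z : A) :=
  GRing.Linear.copy (hoch_lmul z) (hlift (word_lmul_multilin z)).

Lemma hoch_lmul_linear (y : C) : linear (hoch_lmul^~ y).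
Proof.
move=> c z w; pose h : {linear C -> C} := c \*: hoch_lmul z \+ hoch_lmul w.
suff : hoch_lmul (c *: z + w) =1 h by move/(_ y).
apply: hoch_eq => b s; rewrite /= /hoch_lmul !hlift_word.
by rewrite mulrDl -scalerAl wordD0.
Qed.

Lemma word_prod_multilin (y : C) :
  multilin (fun a s => if s is [::] then hoch_lmul (handle a) y else 0).
Proof.
split=> [[|? ?] c a a'|a [|? ?] s2 c x x'|a [|? ?] s2] //;
  rewrite ?scaler0 ?addr0 //.
by rewrite handle_is_linear hoch_lmul_linear.
Qed.

Definition hoch_prod (x y : C) : C := hlift (word_prod_multilin y) x.

Lemma hoch_prod_bilin : bilin hoch_prod.
Proof.
split=> [y|x c y y']; first exact: linearP.
pose h : {linear C -> C} :=
  c \*: hlift (word_prod_multilin y) \+ hlift (word_prod_multilin y').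
suff : hlift (word_prod_multilin (c *: y + y')) =1 h by move/(_ x).
apply: hoch_eq => a s; rewrite /= !hlift_word.
by case: s => [|? ?]; rewrite ?linearP // scaler0 addr0.
Qed.

Lemma hoch_prod_word (a b : A) (s t : seq A) :
  hoch_prod (word a s) (word b t) =
  if s is [::] then word (handle a * b) t else 0.
Proof.
by rewrite /hoch_prod hlift_word; case: s => //; rewrite /hoch_lmul hlift_word.
Qed.

End HochschildProduct.

(* BV-algebras over Z/2: no unit is required, and e is the degree of Delta. *)
Record BV_algebra (H : lmodType 'F_2) (G : int -> {pred H}) (e : int)
    (mul : H -> H -> H) (Delta : H -> H) : Prop := {
  BV_grading : is_grading G;
  BV_mul_bilin : bilin mul;
  BV_mul_gr : forall p q x y, x \in G p -> y \in G q -> mul x y \in G (p + q);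
  BV_mulA : associative mul;
  BV_mulC : commutative mul;
  BV_Delta_linear : linear Delta;
  BV_degree : e = 1 \/ e = -1;
  BV_Delta_gr : forall p x, x \in G p -> Delta x \in G (p + e);
  BV_Delta2 : forall x, Delta (Delta x) = 0;
  BV_seven_term : forall a b c,
    Delta (mul (mul a b) c) =
      mul (Delta (mul a b)) c + mul a (Delta (mul b c)) + mul b (Delta (mul a c))
      + mul (mul (Delta a) b) c + mul (mul a (Delta b)) c
      + mul (mul a b) (Delta c)
}.

(* Main.v *)
(* Let e = delta(1) = sum e' (x) e''. Since delta(a) = a e = e a, letters move
   across e: xe' (x) e'' = e' (x) e''x, and by symmetry of e also
   e'x (x) e'' = e' (x) xe''. Hence h(a) = sum e' a e'' is central, kills
   commutators and commutes with d, and the product is x o y = z y, where z is h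
   of the length zero component of x.

   On a0[a1,...,an] and b0[b1,...,bq] put
     K(a,b) = sum e'a0[a1,...,an,e''b0,b1,...,bq],
     H(a,b) = sum_j 1[bj,...,bq,e'a0,a1,...,an,e''b0,b1,...,b(j-1)]
   (1 <= j <= q + 1). Then
     dK + Kd = a o b + b o a,   dH + Hd = B(a o b) + K(a,b) + K(b,a),
   and K is linear over the center. The first identity is commutativity in
   homology. As B(a) and K(a,b) have no component of length zero, they annihilate
   everything when multiplied from the left, hence, in homology, from either
   side. So all terms on the right of the seven-term relation vanish. On the left,
   up to boundaries, B(a o b o c) = B(b o (z c)) = z (K(b,c) + K(c,b))
   = a o (K(b,c) + K(c,b)) = (K(b,c) + K(c,b)) o a = 0. *)

From HB Require Import structures.
Require Import Defs.
From mathcomp Require Import all_boot all_order all_algebra.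
From mathcomp Require Import boolp zify.

Set Implicit Arguments.
Unset Strict Implicit.
Unset Printing Implicit Defensive.

Import GRing.Theory.
Local Open Scope ring_scope.

(** * Sums over the slots and the splittings of a word *)

Section Splittings.
Variables (A : algType 'F_2) (W : lmodType 'F_2).
Implicit Types (g : seq A -> W) (F G : seq A -> seq A -> W) (s t l : seq A).

Definition sum_split F t : W := \sum_(i < (size t).+1) F (take i t) (drop i t).

Lemma sum_split0 F : sum_split F [::] = F [::] [::].
Proof. by rewrite /sum_split big_ord1. Qed.

Lemma sum_split_cons F x t :
  sum_split F (x :: t) = F [::] (x :: t) + sum_split (F \o cons x) t.
Proof. by rewrite /sum_split /= big_ord_recl. Qed.

Lemma sum_split_rcons F t z : sum_split F (rcons t z) =
  sum_split (fun p q => F p (rcons q z)) t + F (rcons t z) [::].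
Proof.
elim: t F => [|y t IH] F /=; first by rewrite sum_split_cons !sum_split0.
by rewrite !sum_split_cons IH addrA.
Qed.

Lemma eq_sum_split F G t : (forall p q, F p q = G p q) ->
  sum_split F t = sum_split G t.
Proof. by move=> FG; apply: eq_bigr. Qed.

Lemma sum_splitD F G t :
  sum_split (fun p q => F p q + G p q) t = sum_split F t + sum_split G t.
Proof. exact: big_split. Qed.

Lemma sum_apply0 (d : A -> A) g : sum_apply d g [::] = 0.
Proof. by rewrite /sum_apply big_ord0. Qed.

Lemma sum_merge0 g : sum_merge g [::] = 0.
Proof. by rewrite /sum_merge big_ord0. Qed.

Lemma sum_merge1 g x : sum_merge g [:: x] = 0.
Proof. by rewrite /sum_merge big_ord0. Qed.

Lemma eq_sum_apply (d : A -> A) g g' s : g =1 g' ->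
  sum_apply d g s = sum_apply d g' s.
Proof. by move=> gg; apply: eq_bigr => i _; apply: gg. Qed.

Lemma eq_sum_merge g g' s : g =1 g' -> sum_merge g s = sum_merge g' s.
Proof. by move=> gg; apply: eq_bigr => i _; apply: gg. Qed.

Lemma sum_apply_sum (d : A -> A) (I : finType) (f : I -> seq A -> W) s :
  sum_apply d (fun r => \sum_i f i r) s = \sum_i sum_apply d (f i) s.
Proof. exact: exchange_big. Qed.

Lemma sum_merge_sum (I : finType) (f : I -> seq A -> W) s :
  sum_merge (fun r => \sum_i f i r) s = \sum_i sum_merge (f i) s.
Proof. exact: exchange_big. Qed.

Lemma sum_apply_sum_split (d : A -> A) (f : seq A -> seq A -> seq A -> W) l t :
  sum_apply d (fun r => sum_split (f r) t) l =
  sum_split (fun p q => sum_apply d (fun r => f r p q) l) t.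
Proof. exact: exchange_big. Qed.

Lemma sum_merge_sum_split (f : seq A -> seq A -> seq A -> W) l t :
  sum_merge (fun r => sum_split (f r) t) l =
  sum_split (fun p q => sum_merge (fun r => f r p q) l) t.
Proof. exact: exchange_big. Qed.

Lemma sum_applyD (d : A -> A) g g' s :
  sum_apply d (fun r => g r + g' r) s = sum_apply d g s + sum_apply d g' s.
Proof. exact: big_split. Qed.

Lemma sum_mergeD g g' s :
  sum_merge (fun r => g r + g' r) s = sum_merge g s + sum_merge g' s.
Proof. exact: big_split. Qed.

Lemma sum_apply_cat (d : A -> A) g s t : sum_apply d g (s ++ t) =
  sum_apply d (fun r => g (r ++ t)) s + sum_apply d (fun r => g (s ++ r)) t.
Proof.
elim: s g => [|x s IH] g /=; first by rewrite sum_apply0 add0r.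
by rewrite !sum_apply_cons IH addrA.
Qed.

Lemma sum_apply_rcons (d : A -> A) g s x : sum_apply d g (rcons s x) =
  sum_apply d (g \o rcons^~ x) s + g (rcons s (d x)).
Proof.
rewrite -cats1 sum_apply_cat sum_apply_cons sum_apply0 addr0 cats1.
by congr (_ + _); apply: eq_sum_apply => r /=; rewrite cats1.
Qed.

Lemma sum_merge_cat_cons g s x t : sum_merge g (s ++ x :: t) =
  sum_merge (fun r => g (r ++ t)) (rcons s x)
  + sum_merge (fun r => g (s ++ r)) (x :: t).
Proof.
elim: s g => [|y s IH] g /=; first by rewrite sum_merge1 add0r.
case: s IH => [|z s] IH /=.
  by rewrite !sum_merge_cons sum_merge1 addr0.
by rewrite !sum_merge_cons /= (IH (g \o cons y)) cat_rcons addrA.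
Qed.

Lemma sum_merge_rcons2 g s x y : sum_merge g (rcons (rcons s x) y) =
  sum_merge (g \o rcons^~ y) (rcons s x) + g (rcons s (x * y)).
Proof.
elim: s g => [|z s IH] g /=; first by rewrite sum_merge_cons !sum_merge1 addrC.
case: s IH => [|w s] IH /=; last first.
  by rewrite !sum_merge_cons /= (IH (g \o cons z)) addrA.
by rewrite !sum_merge_cons /= !sum_merge1 !addr0.
Qed.

(** The wrap-around term of the boundary takes off the last letter of a word; in [s ++ y :: t] that
    letter always comes from the second piece. *)
Lemma last_belast_cat (G : A -> seq A -> W) s y t :
  (if s ++ y :: t is x :: s' then G (last x s') (belast x s') else 0) =
  G (last y t) (s ++ belast y t).
Proof.
case: s => [|x s] //=; rewrite last_cat belast_cat /=.
by rewrite -[belast x s ++ _]cat_rcons -lastI.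
Qed.

(** The only merge in [s ++ t] that involves both pieces, hence the correction term in
    [sum_merge_cat]. *)
Definition merge_across g s t : W :=
  if s is x :: s' then
    if t is y :: t' then g (belast x s' ++ last x s' * y :: t') else 0
  else 0.

Lemma sum_merge_cat g s t : sum_merge g (s ++ t) =
  sum_merge (fun r => g (r ++ t)) s + sum_merge (fun r => g (s ++ r)) t
  + merge_across g s t.
Proof.
case: s => [|x s] /=; first by rewrite sum_merge0 add0r addr0.
case: t => [|y t].
  rewrite cats0 sum_merge0 !addr0; apply: eq_sum_merge => r.
  by rewrite cats0.
rewrite -cat_cons lastI sum_merge_cat_cons sum_merge_rcons2 cat_rcons addrAC.
by congr (_ + _ + _); apply: eq_sum_merge => r /=; 
  rewrite ?cat_rcons // -cat_cons (lastI x) cat_rcons.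
Qed.

(** The splittings whose second half is nonempty correspond to all splittings of the word without
    its last letter. The next lemma is the mirror image, with the first letter removed. *)
Lemma sum_split_last (G : seq A -> seq A -> A -> W) t :
  sum_split (fun p q => if q is y :: q' then G p (belast y q') (last y q') else 0) t
  = if t is y :: t' then sum_split (fun p q => G p q (last y t')) (belast y t')
    else 0.
Proof.
case/lastP: t => [|t z]; first by rewrite sum_split0.
rewrite sum_split_rcons addr0.
transitivity (sum_split (fun p q => G p q z) t); last first.
  by case: t => //= x t; rewrite last_rcons belast_rcons.
by apply: eq_sum_split => p [|x q] //=; rewrite last_rcons belast_rcons.
Qed.

Lemma sum_split_head (G : seq A -> seq A -> A -> W) t :
  sum_split (fun p q => if p is y :: p' then G p' q y else 0) t
  = if t is y :: t' then sum_split (fun p q => G p q y) t' else 0.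
Proof.
case: t => [|y t]; first by rewrite sum_split0.
by rewrite sum_split_cons add0r.
Qed.

(** The value of [E] at the cut before a letter equals that of [E'] at the cut after it. These pairs
    cancel modulo 2 and leave one outermost cut for each function. *)
Lemma sum_split_telescope (E E' : seq A -> seq A -> W) t :
  (forall p z q, E' (rcons p z) q = E p (z :: q)) ->
  sum_split E t + sum_split E' t = E t [::] + E' [::] t.
Proof.
elim: t E E' => [|x t IH] E E' EE'; first by rewrite !sum_split0.
rewrite !sum_split_cons addrACA IH /=; last by move=> p z q; apply: (EE' (x :: p)).
rewrite -(EE' [::] x t : E' [:: x] t = _) [E' [:: x] t + _]addrC addrACA.
by rewrite addrr_F2 addr0 addrC.
Qed.

Lemma sum_apply_split (d : A -> A) F t :
  sum_split (fun p q => sum_apply d (F p) q + sum_apply d (F^~ q) p) t =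
  sum_apply d (sum_split F) t.
Proof.
elim: t F => [|x t IH] F; first by rewrite sum_split0 !sum_apply0 addr0.
rewrite sum_split_cons /= !sum_apply_cons sum_apply0 addr0 sum_split_cons -!addrA.
congr (_ + _).
rewrite (@eq_sum_apply d (sum_split F \o cons x)
  (fun r => F [::] (x :: r) + sum_split (F \o cons x) r));
  last by move=> r /=; rewrite sum_split_cons.
rewrite sum_applyD -IH addrCA; congr (_ + _).
rewrite -sum_splitD; apply: eq_sum_split => p q /=.
by rewrite sum_apply_cons addrCA.
Qed.

(** A splitting of a word in which two neighbours have been merged is a splitting of the original
    word that does not separate them, so both sides only see merges inside one half. *)
Lemma sum_merge_split F t :
  sum_split (fun p q => sum_merge (F p) q + sum_merge (F^~ q) p) t =
  sum_merge (sum_split F) t.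
Proof.
elim: t F => [|x t IH] F; first by rewrite sum_split0 !sum_merge0 addr0.
rewrite sum_split_cons /= sum_merge0 addr0.
case: t IH => [|y t] IH; first by rewrite sum_split0 /= !sum_merge1 sum_merge0 !addr0.
rewrite !sum_merge_cons (sum_split_cons F) -!addrA; congr (_ + _).
rewrite (@eq_sum_merge (sum_split F \o cons x)
  (fun r => F [::] (x :: r) + sum_split (F \o cons x) r)
  (y :: t)); last first.
  by move=> r /=; rewrite sum_split_cons.
rewrite sum_mergeD -IH addrCA; congr (_ + _).
rewrite !sum_split_cons /= !sum_merge0 sum_merge1 addrCA; congr (_ + _).
rewrite -sum_splitD; apply: eq_sum_split => p q /=.
by rewrite sum_merge_cons addrCA.
Qed.

End Splittings.

(** * The Hochschild boundary of cyclic words *)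

Section BlockSums.
Variable A : dgAlgebra.
Local Notation C := (hoch A).
Local Notation d := (dga_d A).
Implicit Types (a x y z : A) (l r s t : seq A).

(** Treating the coefficient as the first letter lets the slot sums act on it as well. The empty
    word represents no chain and goes to [0]. *)
Definition word_of l : C := if l is a :: s then word a s else 0.

Lemma word_of_slot_linear : slot_linear word_of.
Proof.
case=> [|a s1] s2 c x y; first exact: wordD0.
exact: wordD.
Qed.

Lemma hoch_dint_word a s : hoch_dint (word a s) = sum_apply d word_of (a :: s).
Proof. by rewrite /hoch_dint hlift_word sum_apply_cons. Qed.

(** The term [a0a1] is one more merge of neighbours, so only the wrap-around term is left apart. *)
Lemma hoch_dext_word a s : hoch_dext (word a s) =
  sum_merge word_of (a :: s)
  + if s is x :: s' then word (last x s' * a) (belast x s') else 0.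
Proof.
rewrite /hoch_dext hlift_word; case: s => [|x s] /=.
  by rewrite sum_merge1 addr0.
by rewrite sum_merge_cons.
Qed.

Lemma hoch_dint_word1 s : hoch_dint (word 1 s) = sum_apply d (word 1) s.
Proof.
rewrite hoch_dint_word sum_apply_cons dga_d1 /=.
have := @wordD0 A s (-1) 0 0; rewrite !scaleN1r !addNr => ->.
by rewrite add0r.
Qed.

Lemma hoch_dext_word1 s : hoch_dext (word 1 s) =
  word_of s + sum_merge (word 1) s
  + if s is x :: s' then word (last x s') (belast x s') else 0.
Proof.
rewrite hoch_dext_word; case: s => [|x s].
  by rewrite sum_merge1 sum_merge0 !addr0.
by rewrite sum_merge_cons mul1r mulr1.
Qed.

(** Block and rest are separate arguments, as in [rot], so that both functions can be fed to the
    same construction [block_op]. *)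
Definition word_cat l t : C := word_of (l ++ t).

(** The rotations of the cyclic word [l ++ t] that do not cut the block [l]. For a one-letter block
    this is the Connes operator. *)
Definition rot l t : C := sum_split (fun p q => word 1 (q ++ l ++ p)) t.

Lemma connes_word a s : connes (word a s) = rot [:: a] s.
Proof. by rewrite /connes hlift_word. Qed.

(* The cyclic merges of the letters of (x :: l) ++ t, kept apart in the block
   x :: l and the rest t, except for the wrap around the block when t = [::]. *)
Definition block_merge (F : seq A -> seq A -> C) x l t : C :=
  sum_merge (F^~ t) (x :: l) + sum_merge (F (x :: l)) t
  + if t is y :: t' then
      F (rcons (belast x l) (last x l * y)) t'
      + F (last y t' * x :: l) (belast y t')
    else 0.

Lemma hoch_dint_word_cat x l t : hoch_dint (word_cat (x :: l) t) =
  sum_apply d (word_cat^~ t) (x :: l) + sum_apply d (word_cat (x :: l)) t.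
Proof. by rewrite /word_cat /= hoch_dint_word -cat_cons sum_apply_cat. Qed.

(** With an empty rest, the wrap-around joins the two ends of the block itself. [block_merge] leaves
    this term out, so it appears separately. *)
Lemma hoch_dext_word_cat x l y t :
  hoch_dext (word_cat (x :: rcons l y) t) =
  block_merge word_cat x (rcons l y) t
  + if t is [::] then word (y * x) l else 0.
Proof.
rewrite /word_cat /= hoch_dext_word -cat_cons sum_merge_cat /block_merge -!addrA.
congr (_ + (_ + _)); case: t => [|z t].
  rewrite /= cats0 !add0r; case: l => //= w l.
  by rewrite last_rcons belast_rcons.
rewrite addr0 /= last_rcons belast_rcons cat_rcons; congr (_ + _).
  by rewrite cat_rcons.
by rewrite (last_belast_cat (fun u r => word (u * x) r)) cat_rcons.
Qed.

Lemma hoch_dint_rot l t : hoch_dint (rot l t) =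
  sum_apply d (rot^~ t) l + sum_apply d (rot l) t.
Proof.
transitivity (sum_split (fun p q => hoch_dint (word 1 (q ++ l ++ p))) t).
  exact: linear_sum.
rewrite /rot sum_apply_sum_split -sum_apply_split -sum_splitD.
by apply: eq_sum_split => p q; rewrite hoch_dint_word1 !sum_apply_cat addrCA.
Qed.

Lemma hoch_dext_rot x l t : hoch_dext (rot (x :: l) t) =
  block_merge rot x l t
  + (word_cat (x :: l) t + word (last x l) (t ++ belast x l)).
Proof.
(* The boundary of each rotation in three groups: merges inside the block or one of the halves,
   merges across an edge of the block, and the two terms in which the coefficient [1] is
   absorbed. *)
transitivity (sum_split (fun p q =>
    (sum_merge (fun r => word 1 (q ++ r ++ p)) (x :: l) +
     (sum_merge (fun r => word 1 (r ++ (x :: l) ++ p)) q +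
      sum_merge (fun r => word 1 (q ++ (x :: l) ++ r)) p) +
     ((if p is y :: p' then
         word 1 (q ++ rcons (belast x l) (last x l * y) ++ p') else 0) +
      (if q is y :: q' then
         word 1 (belast y q' ++ (last y q' * x :: l) ++ p) else 0))) +
    (word_of (q ++ (x :: l) ++ p) +
     if p is y :: p' then word (last y p') (q ++ (x :: l) ++ belast y p')
     else word (last x l) (q ++ belast x l))) t).
  rewrite /rot /sum_split linear_sum; apply: eq_bigr => i _ /=.
  set p := take i t; set q := drop i t.
  rewrite hoch_dext_word1 addrAC addrC; congr (_ + (_ + _)).
    rewrite sum_merge_cat -cat_cons sum_merge_cat -!addrA addrCA.
    congr (_ + (_ + (_ + (_ + _)))).
    by case: (p) => [|y p'] //=; rewrite cat_rcons.
  case: (p) => [|y p']; first by rewrite cats0 (last_belast_cat (@word A)).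
  by rewrite -cat_cons catA (last_belast_cat (@word A)) -catA.
rewrite 2!sum_splitD /block_merge; congr (_ + _ + _).
- by rewrite /rot sum_merge_sum_split -sum_merge_split -sum_splitD.
- rewrite sum_splitD.
  rewrite (sum_split_head (fun p q y =>
    word 1 (q ++ rcons (belast x l) (last x l * y) ++ p))).
  rewrite (sum_split_last (fun p q y => word 1 (q ++ (y * x :: l) ++ p))).
  by case: t => [|y t]; rewrite ?addr0.
(* Absorbing the unit turns the letter on either side of the cut of the cyclic word into the
   coefficient. Neighbouring rotations give the same word, so the sum telescopes to two end
   terms. *)
rewrite sum_splitD sum_split_telescope ?cats0 ?drop0 // => p z q.
case: p => [|y p] /=; first by rewrite cats0.
by rewrite last_rcons belast_rcons.
Qed.

End BlockSums.

(** * Bilinear operations on Hochschild chains *)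

Section Bilinear.
Variable K : fieldType.
Implicit Types U V W : lmodType K.

(** Bilinearity is a mere predicate, so the partial map is first packed as a linear map. *)
Lemma bilin_suml U V W (f : U -> V -> W) I r (P : pred I) (g : I -> U) v :
  bilin f -> f (\sum_(i <- r | P i) g i) v = \sum_(i <- r | P i) f (g i) v.
Proof.
case=> fl _; pose h := HB.pack_for {linear U -> W} (f^~ v)
  (GRing.isLinear.Build K U W *:%R (f^~ v) (fl v)).
exact: (linear_sum h).
Qed.

Lemma bilin_sumr U V W (f : U -> V -> W) I r (P : pred I) (g : I -> V) u :
  bilin f -> f u (\sum_(i <- r | P i) g i) = \sum_(i <- r | P i) f u (g i).
Proof.
case=> _ fr; pose h := HB.pack_for {linear V -> W} (f u)
  (GRing.isLinear.Build K V W *:%R (f u) (fr u)).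
exact: (linear_sum h).
Qed.

Lemma bilinDl U V W (f : U -> V -> W) u u' v :
  bilin f -> f (u + u') v = f u v + f u' v.
Proof. by case=> fl _; have := fl v 1 u u'; rewrite !scale1r. Qed.

Lemma bilinDr U V W (f : U -> V -> W) u v v' :
  bilin f -> f u (v + v') = f u v + f u v'.
Proof. by case=> _ fr; have := fr u 1 v v'; rewrite !scale1r. Qed.

Lemma bilin0l U V W (f : U -> V -> W) v : bilin f -> f 0 v = 0.
Proof.
by case=> fl _; have := fl v (-1) 0 0; rewrite scaler0 addr0 scaleN1r addNr.
Qed.

Lemma bilin0r U V W (f : U -> V -> W) u : bilin f -> f u 0 = 0.
Proof.
by case=> _ fr; have := fr u (-1) 0 0; rewrite scaler0 addr0 scaleN1r addNr.
Qed.

Lemma bilin_add U V W (f g : U -> V -> W) :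
  bilin f -> bilin g -> bilin (fun u v => f u v + g u v).
Proof.
by move=> [fl fr] [gl gr]; split=> [v|u] a x y /=;
  rewrite ?fl ?gl ?fr ?gr scalerDr addrACA.
Qed.

Lemma bilin_comp U U' V V' W W' (f : U -> V -> W) (h : {linear W -> W'})
    (k : {linear U' -> U}) (l : {linear V' -> V}) :
  bilin f -> bilin (fun u v => h (f (k u) (l v))).
Proof.
by move=> [fl fr]; split=> [v|u] a x y /=; rewrite linearP ?fl ?fr linearP.
Qed.

Lemma bilin_flip U V W (f : U -> V -> W) : bilin f -> bilin (fun v u => f u v).
Proof. by case=> fl fr; split. Qed.

End Bilinear.

Section HochBilinear.
Variables (A : algType 'F_2) (W : lmodType 'F_2).
Local Notation C := (hoch A).

Section Lift.
Variable f : A -> seq A -> A -> seq A -> W.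
Hypothesis f_left : forall c t, multilin (fun a s => f a s c t).
Hypothesis f_right : forall a s, multilin (f a s).

(** The right argument is lifted first; the conditions on the left one then only have to be compared
    on words. *)
Lemma hlift_right_multilin (y : C) :
  multilin (fun a s => hlift (f_right a s) y).
Proof.
split=> [s k a a'|a s1 s2 k x x'|a s1 s2].
- pose h : {linear C -> W} := k \*: hlift (f_right a s) \+ hlift (f_right a' s).
  suff : hlift (f_right (k *: a + a') s) =1 h by move/(_ y).
  apply: hoch_eq => c t; rewrite /= !hlift_word.
  by case: (f_left c t) => fl _ _; apply: fl.
- pose h : {linear C -> W} := k \*: hlift (f_right a (s1 ++ x :: s2))
    \+ hlift (f_right a (s1 ++ x' :: s2)).
  suff : hlift (f_right a (s1 ++ (k *: x + x') :: s2)) =1 h by move/(_ y).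
  apply: hoch_eq => c t; rewrite /= !hlift_word.
  by case: (f_left c t) => _ fl _; apply: fl.
pose h : {linear C -> W} := \0.
suff : hlift (f_right a (s1 ++ 1 :: s2)) =1 h by move/(_ y).
apply: hoch_eq => c t; rewrite /= !hlift_word.
by case: (f_left c t) => _ _ fl; apply: fl.
Qed.

Definition hlift2 (x y : C) : W := hlift (hlift_right_multilin y) x.

Lemma hlift2_bilin : bilin hlift2.
Proof.
split=> [y|x k y y']; first exact: linearP.
pose h : {linear C -> W} :=
  k \*: hlift (hlift_right_multilin y) \+ hlift (hlift_right_multilin y').
suff : hlift (hlift_right_multilin (k *: y + y')) =1 h by move/(_ x).
by apply: hoch_eq => a s; rewrite /= !hlift_word linearP.
Qed.

Lemma hlift2_word a s c t : hlift2 (word a s) (word c t) = f a s c t.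
Proof. by rewrite /hlift2 !hlift_word. Qed.

End Lift.

Lemma hoch_bilin_eq (f g : C -> C -> W) : bilin f -> bilin g ->
  (forall a s c t, f (word a s) (word c t) = g (word a s) (word c t)) ->
  forall x y, f x y = g x y.
Proof.
move=> [fl fr] [gl gr] fg x y.
pose lin (h : C -> W) (hl : linear h) :=
  HB.pack_for {linear C -> W} h (GRing.isLinear.Build 'F_2 C W *:%R h hl).
suff /(_ x) : lin _ (fl y) =1 lin _ (gl y) by [].
apply: hoch_eq => a s /=.
suff /(_ y) : lin _ (fr (word a s)) =1 lin _ (gr (word a s)) by [].
by apply: hoch_eq => c t /=; apply: fg.
Qed.

End HochBilinear.

(** * The Casimir element *)

Section TensorSums.
Variables (K : fieldType) (U V W : lmodType K).

Lemma pure_bilin : bilin (@pure K U V).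
Proof. by split=> [v a x x'|x a v v']; [apply: pureDl | apply: pureDr]. Qed.

Lemma tlift_sum (f : U -> V -> W) (fb : bilin f) I (r : seq I) (P : pred I) x y :
  tlift fb (\sum_(i <- r | P i) x i *t y i) = \sum_(i <- r | P i) f (x i) (y i).
Proof. by rewrite linear_sum; apply: eq_bigr => i _; apply: tlift_pure. Qed.

End TensorSums.

Lemma tmap_sum (K : fieldType) (U U' V V' : lmodType K) (f : {linear U -> U'})
    (g : {linear V -> V'}) I (r : seq I) (P : pred I) x y :
  tmap f g (\sum_(i <- r | P i) x i *t y i) =
  \sum_(i <- r | P i) f (x i) *t g (y i).
Proof. exact: tlift_sum. Qed.

Section LinearSlots.
Variables (A : algType 'F_2) (W : lmodType 'F_2).

Lemma slot_bilin (g : seq A -> W) a s c r : slot_linear g ->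
  bilin (fun x y => g (x * a :: s ++ y * c :: r)).
Proof.
move=> gl; split=> [y|x] k z z' /=; rewrite mulrDl -scalerAl.
  exact: (gl [::]).
exact: (gl (x * a :: s)).
Qed.

Lemma slot_bilin_rcons (g : seq A -> W) a s c : slot_linear g ->
  bilin (fun x y => g (x * a :: rcons s (y * c))).
Proof.
move=> gl; have [hl hr] := slot_bilin a s c [::] gl.
by split=> [y|x] k z z'; rewrite -!cats1; [apply: hl | apply: hr].
Qed.

Lemma bilin_sum_applyl (U V : lmodType 'F_2) (f : W -> U -> V) (d : A -> A)
    (g : seq A -> W) s y : bilin f ->
  f (sum_apply d g s) y = sum_apply d (fun r => f (g r) y) s.
Proof. exact: bilin_suml. Qed.

Lemma bilin_sum_applyr (U V : lmodType 'F_2) (f : U -> W -> V) (d : A -> A)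
    (g : seq A -> W) s y : bilin f ->
  f y (sum_apply d g s) = sum_apply d (fun r => f y (g r)) s.
Proof. exact: bilin_sumr. Qed.

Lemma bilin_sum_mergel (U V : lmodType 'F_2) (f : W -> U -> V)
    (g : seq A -> W) s y : bilin f ->
  f (sum_merge g s) y = sum_merge (fun r => f (g r) y) s.
Proof. exact: bilin_suml. Qed.

Lemma bilin_sum_merger (U V : lmodType 'F_2) (f : U -> W -> V)
    (g : seq A -> W) s y : bilin f ->
  f y (sum_merge g s) = sum_merge (fun r => f y (g r)) s.
Proof. exact: bilin_sumr. Qed.

Lemma slotD (g : seq A -> W) s1 s2 x y : slot_linear g ->
  g (s1 ++ (x + y) :: s2) = g (s1 ++ x :: s2) + g (s1 ++ y :: s2).
Proof. by move=> gl; have := gl s1 s2 1 x y; rewrite !scale1r. Qed.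

Lemma slot0 (g : seq A -> W) s1 s2 : slot_linear g -> g (s1 ++ 0 :: s2) = 0.
Proof.
by move=> gl; have := gl s1 s2 (-1) 0 0; rewrite scaler0 addr0 scaleN1r addNr.
Qed.

Lemma slot_sum (g : seq A -> W) s1 s2 (I : finType) (x : I -> A) :
  slot_linear g ->
  g (s1 ++ (\sum_i x i) :: s2) = \sum_i g (s1 ++ x i :: s2).
Proof.
move=> gl; elim/big_rec2: _ => [|i y z _ <-]; first exact: slot0.
exact: slotD.
Qed.

End LinearSlots.

Section Casimir.
Variables (m : int) (A : openFrobenius m) (N : nat) (u v : 'I_N -> A).
Hypothesis symA : symmetric_frobenius A.
Hypothesis copE : of_cop A 1 = \sum_i u i *t v i.
Local Notation d := (dga_d A).
Variable W : lmodType 'F_2.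
Implicit Types f : A -> A -> W.

Lemma casimir_tlift f (fb : bilin f) :
  tlift fb (of_cop A 1) = \sum_i f (u i) (v i).
Proof. by rewrite copE tlift_sum. Qed.

Lemma casimir_sym f : bilin f ->
  \sum_i f (u i) (v i) = \sum_i f (v i) (u i).
Proof.
move=> fb; rewrite -(casimir_tlift fb) -symA copE.
by rewrite /tswap tlift_sum tlift_sum.
Qed.

(** Both sides come from the coproduct of [x], computed once by the left and once by the right
    module structure. *)
Lemma casimir_outer f x : bilin f ->
  \sum_i f (x * u i) (v i) = \sum_i f (u i) (v i * x).
Proof.
move=> fb; have : of_cop A (x * 1) = of_cop A (1 * x) by rewrite mulr1 mul1r.
rewrite of_copMl of_copMr copE !tmap_sum => /(congr1 (tlift fb)).
by rewrite !tlift_sum.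
Qed.

(** [casimir_outer] with the two legs exchanged by symmetry before and after. *)
Lemma casimir_inner f x : bilin f ->
  \sum_i f (u i * x) (v i) = \sum_i f (u i) (x * v i).
Proof.
move=> fb; have flipb := bilin_flip fb.
have fbl : bilin (fun y z => f (y * x) z).
  by split=> [z|y] k y1 y2; [rewrite mulrDl -scalerAl; apply: fb.1 | apply: fb.2].
have fbr : bilin (fun y z => f y (x * z)).
  by split=> [z|y] k y1 y2; [apply: fb.1 | rewrite mulrDr -scalerAr; apply: fb.2].
by rewrite (casimir_sym fbl) -(casimir_outer x flipb) (casimir_sym fbr).
Qed.

(** The coproduct is a chain map and [d 1 = 0], so the coproduct of [1] is a cycle. *)
Lemma casimir_d f : bilin f ->
  \sum_i f (d (u i)) (v i) + \sum_i f (u i) (d (v i)) = 0.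
Proof.
move=> fb; have := of_copd (o := A) 1.
rewrite dga_d1 linear0 copE /tensor_d !tmap_sum => e.
rewrite -(tlift_sum fb _ _ (fun i => d (u i)) v).
rewrite -(tlift_sum fb _ _ u (fun i => d (v i))).
by rewrite -[LHS]linearD -e linear0.
Qed.

End Casimir.

(** * Operations inserting the Casimir element between two words *)

(** Normality is asked behind a first letter of the block: for [word_cat] that letter is the
    coefficient, where a unit does not give zero. *)
Definition block_multilin (A : algType 'F_2) (W : lmodType 'F_2)
    (F : seq A -> seq A -> W) :=
  [/\ forall t, slot_linear (F^~ t), forall l, slot_linear (F l),
      forall x t, slot_normal (fun l => F (x :: l) t)
    & forall x l, slot_normal (F (x :: l))].

Section Operations.
Variables (m : int) (A : openFrobenius m) (N : nat) (u v : 'I_N -> A).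
Hypothesis symA : symmetric_frobenius A.
Hypothesis copE : of_cop A 1 = \sum_i u i *t v i.
Local Notation C := (hoch A).
Local Notation d := (dga_d A).

Lemma mul3_bilin (a : A) : bilin (fun x y : A => x * a * y).
Proof.
split=> [y|x] k z z' /=; first by rewrite !mulrDl -!scalerAl.
by rewrite mulrDr -scalerAr.
Qed.

(** The definition yields the order [e'' a e']; symmetry of the Casimir element turns it into
    [e' a e'']. *)
Lemma handleE (a : A) : handle a = \sum_i u i * a * v i.
Proof.
rewrite /handle -[a in LHS]mulr1 of_copMl copE tmap_sum tlift_sum.
rewrite (casimir_sym symA copE (mul3_bilin a)).
by apply: eq_bigr => i _; rewrite /= mulrA.
Qed.

Lemma handle_central (a x : A) : x * handle a = handle a * x.
Proof.
rewrite handleE mulr_sumr mulr_suml.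
have := casimir_outer copE x (mul3_bilin a).
under [X in X = _ -> _]eq_bigr do rewrite -!mulrA.
under [X in _ = X -> _]eq_bigr do rewrite mulrA.
by under [X in _ -> X = _]eq_bigr do rewrite -mulrA.
Qed.

Lemma handleC (a b : A) : handle (a * b) = handle (b * a).
Proof.
rewrite !handleE; have := casimir_inner symA copE a (mul3_bilin b).
under [X in X = _ -> _]eq_bigr do rewrite -[u _ * a * b]mulrA.
by under [X in _ = X -> _]eq_bigr do rewrite mulrA -[u _ * b * a]mulrA.
Qed.

Lemma handle_mull (z b : A) : (forall a, a * z = z * a) ->
  handle (z * b) = z * handle b.
Proof.
move=> zC; rewrite !handleE mulr_sumr; apply: eq_bigr => i _.
by rewrite !mulrA zC.
Qed.

Lemma handle_d (a : A) : d (handle a) = handle (d a).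
Proof.
rewrite !handleE linear_sum /=.
under eq_bigr do rewrite !dga_leibniz mulrDl addrAC.
by rewrite !big_split /= (casimir_d copE (mul3_bilin a)) add0r.
Qed.

Section BlockOperation.
Variable F : seq A -> seq A -> C.
Hypothesis Fml : block_multilin F.

(** The block is [e'a0, a1, ..., an, e''b0] and the rest is [b1, ..., bq]. Taking [word_cat] or
    [rot] for [F] gives the homotopies K and H. *)
Definition block_word a s c t : C :=
  \sum_i F (u i * a :: rcons s (v i * c)) t.

Lemma block_word_left c t : multilin (fun a s => block_word a s c t).
Proof.
case: Fml => Fl Fr Fn1 Fn2; split=> [s k a a'|a s1 s2 k x x'|a s1 s2].
- rewrite scaler_sumr -big_split; apply: eq_bigr => i _ /=.
  by rewrite mulrDr -scalerAr; apply: (Fl t [::]).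
- rewrite scaler_sumr -big_split; apply: eq_bigr => i _ /=.
  by rewrite !rcons_cat !rcons_cons -!cat_cons; apply: (Fl t).
by rewrite /block_word big1 // => i _; rewrite rcons_cat rcons_cons; apply: Fn1.
Qed.

Lemma block_word_right a s : multilin (block_word a s).
Proof.
case: Fml => Fl Fr Fn1 Fn2; split=> [t k c c'|c s1 s2 k x x'|c s1 s2].
- rewrite scaler_sumr -big_split; apply: eq_bigr => i _ /=.
  by rewrite mulrDr -scalerAr -!cats1; apply: (Fl t (_ :: s)).
- rewrite scaler_sumr -big_split; apply: eq_bigr => i _ /=.
  exact: Fr.
by rewrite /block_word big1 // => i _; apply: Fn2.
Qed.

Definition block_op : C -> C -> C := hlift2 block_word_left block_word_right.

Lemma block_op_bilin : bilin block_op.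
Proof. exact: hlift2_bilin. Qed.

Lemma block_op_word a s c t : block_op (word a s) (word c t) = block_word a s c t.
Proof. exact: hlift2_word. Qed.

Lemma block_op_dint a s c t :
  \sum_i (sum_apply d (F^~ t) (u i * a :: rcons s (v i * c))
          + sum_apply d (F (u i * a :: rcons s (v i * c))) t) =
  block_op (hoch_dint (word a s)) (word c t)
  + block_op (word a s) (hoch_dint (word c t)).
Proof.
have [Fl Fr _ _] := Fml.
have -> : block_op (hoch_dint (word a s)) (word c t) = block_word (d a) s c t
    + \sum_i sum_apply d (fun r => F (u i * a :: rcons r (v i * c)) t) s.
  rewrite hoch_dint_word (bilin_sum_applyl _ _ _ _ block_op_bilin).
  rewrite sum_apply_cons /= block_op_word -sum_apply_sum; congr (_ + _).
  by apply: eq_sum_apply => r; exact: (block_op_word a r c t).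
have -> : block_op (word a s) (hoch_dint (word c t)) = block_word a s (d c) t
    + \sum_i sum_apply d (F (u i * a :: rcons s (v i * c))) t.
  rewrite hoch_dint_word (bilin_sum_applyr _ _ _ _ block_op_bilin).
  rewrite sum_apply_cons /= block_op_word -sum_apply_sum; congr (_ + _).
  by apply: eq_sum_apply => r; exact: (block_op_word a s c r).
rewrite -!big_split /=.
pose f x y := F (x * a :: rcons s (y * c)) t.
have fb : bilin f by exact: (slot_bilin_rcons a s c (Fl t)).
(* Adding the vanishing sum of the terms with [d] on a leg of the Casimir element makes the Leibniz
   terms match index by index. *)
rewrite -[LHS]add0r -[X in X + _](casimir_d copE fb) -!big_split /=.
apply: eq_bigr => i _.
rewrite sum_apply_cons sum_apply_rcons !dga_leibniz.
have /= -> := slotD [::] (rcons s (v i * c)) (d (u i) * a) (u i * d a) (Fl t).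
have := slotD (u i * a :: s) [::] (d (v i) * c) (v i * d c) (Fl t).
rewrite /= !cats1 => ->; rewrite /f.
by rewrite (AC (2*((2*(1*2))*1)) ((1*3)*((2*6)*(4*5*(7*8))))) /= !addrr_F2 !add0r.
Qed.

(** Moving [an] across the Casimir element turns the wrap-around term [an a0] into the merge of [an]
    with [e''b0]. Without letters, the block has the single merge [e'a0e''b0], which sums to
    [handle a * c] and is cancelled by the second term. *)
Lemma block_op_dext_left a s c t :
  \sum_i sum_merge (F^~ t) (u i * a :: rcons s (v i * c))
  + (if s is [::] then F [:: handle a * c] t else 0) =
  block_op (hoch_dext (word a s)) (word c t).
Proof.
have [Fl Fr _ _] := Fml.
rewrite hoch_dext_word (bilinDl _ _ _ block_op_bilin).
rewrite (bilin_sum_mergel _ _ _ block_op_bilin).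
case: s => [|x s].
  rewrite sum_merge1 add0r; under eq_bigr do rewrite /= sum_merge_cons sum_merge1 addr0.
  rewrite (bilin0l _ block_op_bilin) handleE mulr_suml.
  have /= -> := @slot_sum _ _ (F^~ t) [::] [::] _ (fun i => u i * a * v i * c) (Fl t).
  by under eq_bigr do rewrite mulrA; rewrite addrr_F2.
rewrite addr0 sum_merge_cons /= !block_op_word.
rewrite (@eq_sum_merge _ _ _ (fun r => block_word a r c t)); last first.
  by move=> r; exact: (block_op_word a r c t).
rewrite /block_word sum_merge_sum -big_split /=.
have fb := slot_bilin_rcons a (belast x s) c (Fl t).
under [X in _ = _ + X]eq_bigr do rewrite mulrA.
rewrite (casimir_inner symA copE (last x s) fb) -big_split; apply: eq_bigr => i _ /=.
rewrite sum_merge_cons mulrA -addrA; congr (_ + _).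
rewrite -(rcons_cons x) (lastI x s) sum_merge_rcons2.
by rewrite [last x s * (v i * c)]mulrA.
Qed.

(** The term [b0b1] is the merge at the right edge of the block. By [casimir_outer], the wrap-around
    term [bq b0] becomes the merge of [bq] with [e'a0] at the left edge. *)
Lemma block_op_dext_right a s c t :
  \sum_i (sum_merge (F (u i * a :: rcons s (v i * c))) t
    + if t is y :: t' then
      F (u i * a :: rcons s (v i * c * y)) t'
      + F (last y t' * (u i * a) :: rcons s (v i * c)) (belast y t')
    else 0) =
  block_op (word a s) (hoch_dext (word c t)).
Proof.
have [Fl Fr _ _] := Fml.
rewrite hoch_dext_word (bilinDr _ _ _ block_op_bilin).
rewrite (bilin_sum_merger _ _ _ block_op_bilin).
case: t => [|y t].
  rewrite sum_merge1 add0r (bilin0r _ block_op_bilin) big1 // => i _.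
  by rewrite sum_merge0 addr0.
rewrite sum_merge_cons /= !block_op_word.
rewrite (@eq_sum_merge _ _ _ (block_word a s c)); last first.
  by move=> r; exact: (block_op_word a s c r).
rewrite /block_word sum_merge_sum -big_split /=.
have fb := slot_bilin_rcons a s c (Fl (belast y t)).
under [X in _ = _ + X]eq_bigr do rewrite mulrA.
rewrite -(casimir_outer copE (last y t) fb) -big_split; apply: eq_bigr => i _ /=.
by rewrite !mulrA addrCA addrA.
Qed.

Lemma block_op_dext a s c t :
  \sum_i block_merge F (u i * a) (rcons s (v i * c)) t
  + (if s is [::] then F [:: handle a * c] t else 0) =
  block_op (hoch_dext (word a s)) (word c t)
  + block_op (word a s) (hoch_dext (word c t)).
Proof.
rewrite -block_op_dext_left -block_op_dext_right addrAC -big_split.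
congr (_ + _); apply: eq_bigr => i _; rewrite /block_merge -addrA.
by case: t => [|y t] //; rewrite belast_rcons last_rcons.
Qed.

End BlockOperation.
End Operations.

(** * Concatenation and rotation as block operations; the Connes operator on chains *)

Section ConcreteBlocks.
Variable A : dgAlgebra.
Local Notation C := (hoch A).

Lemma word_cat_multilin : block_multilin (@word_cat A).
Proof.
split=> [t|l|x t|x l] s1 s2; rewrite /word_cat /=.
- move=> k y z; rewrite -!catA /=.
  exact: (word_of_slot_linear s1 (s2 ++ t)).
- by move=> k y z; rewrite !catA; apply: word_of_slot_linear.
- by rewrite -catA; apply: word1.
by rewrite catA; apply: word1.
Qed.

(** The words around the slot do not depend on the letter in it, so linearity and normality pass
    from [word] to [rot]. *)
Lemma rot_slot l s1 s2 i : exists p q, forall x : A,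
  drop i (s1 ++ x :: s2) ++ l ++ take i (s1 ++ x :: s2) = p ++ x :: q.
Proof.
have [le_i|lt_i] := leqP i (size s1).
  exists (drop i s1), (s2 ++ l ++ take i s1) => x.
  rewrite drop_cat take_cat; case: ltngtP le_i => // [_|->] _.
    by rewrite -catA.
  by rewrite subnn take_size drop_size /= cats0.
exists (drop (i - size s1).-1 s2 ++ l ++ s1), (take (i - size s1).-1 s2) => x.
rewrite drop_cat take_cat ltnNge (ltnW lt_i) /=.
by rewrite -subn_gt0 in lt_i; case: (_ - _)%N lt_i => //= j _; rewrite -!catA.
Qed.

Lemma rot_multilin : block_multilin (@rot A).
Proof.
have rot_right l s1 s2 : exists (P Q : nat -> seq A), forall x, rot l (s1 ++ x :: s2) =
    \sum_(i < (size s1 + size s2).+2) word 1 (P i ++ x :: Q i).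
  have [PQ PQE] := choice (fun i => rot_slot l s1 s2 i).
  have [Q QE] := choice PQE; exists PQ, Q => x.
  rewrite /rot /sum_split size_cat /= addnS.
  by apply: eq_bigr => i _; rewrite QE.
split=> [t|l|x t|x l] s1 s2.
- move=> k y z; rewrite /rot /sum_split scaler_sumr -big_split.
  by apply: eq_bigr => i _ /=; rewrite -!catA !(catA _ s1) wordD.
- move=> k y z; have [P [Q E]] := rot_right l s1 s2.
  rewrite !E scaler_sumr -big_split; apply: eq_bigr => i _.
  exact: wordD.
- rewrite /rot /sum_split big1 // => i _.
  by rewrite /= -!catA /= -(cat_rcons x) catA word1.
have [P [Q ->]] := rot_right (x :: l) s1 s2.
by rewrite big1 // => i _; rewrite word1.
Qed.

Lemma connes_d (x : C) : connes (hoch_d x) = hoch_d (connes x).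
Proof.
pose f : {linear C -> C} := @connes A \o @hoch_d A.
pose g : {linear C -> C} := @hoch_d A \o @connes A.
suff /(_ x) : f =1 g by [].
apply: hoch_eq => a s; rewrite /= /hoch_d linearD connes_word /=; congr (_ + _).
  rewrite hoch_dint_word hoch_dint_rot !sum_apply_cons sum_apply0 addr0.
  rewrite linearD /= connes_word; congr (_ + _).
  rewrite /sum_apply linear_sum; apply: eq_bigr => i _ /=.
  exact: connes_word.
(* For a one-letter block the two end terms of the boundary are both [word a s] and cancel. *)
rewrite hoch_dext_word hoch_dext_rot /word_cat cats0 addrr_F2 addr0.
rewrite /block_merge sum_merge1 add0r linearD /=.
case: s => [|y s]; first by rewrite sum_merge1 sum_merge0 linear0 !addr0.
rewrite sum_merge_cons linearD /= !connes_word [RHS]addrCA addrA.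
congr (_ + _ + _); rewrite /sum_merge linear_sum; apply: eq_bigr => i _ /=.
exact: connes_word.
Qed.

(** The coefficient [1] made by the first application is a letter after the second, so normalization
    kills every summand. *)
Lemma connes_connes (x : C) : connes (connes x) = 0.
Proof.
pose f : {linear C -> C} := @connes A \o @connes A.
pose g : {linear C -> C} := \0.
suff /(_ x) : f =1 g by [].
apply: hoch_eq => a s /=; rewrite connes_word /rot /sum_split linear_sum.
rewrite big1 // => i _ /=; rewrite connes_word /rot /sum_split big1 // => j _.
by have [p [q pq]] := rot_slot [::] (drop i s) (take i s) j; rewrite ?pq word1.
Qed.

End ConcreteBlocks.

(** * The product *)

Section Product.
Variables (m : int) (A : openFrobenius m).
Hypothesis symA : symmetric_frobenius A.
Local Notation C := (hoch A).
Local Notation d := (dga_d A).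

Lemma casimir_exists : exists N (u v : 'I_N -> A),
  of_cop A 1 = \sum_i u i *t v i.
Proof.
have [s [c e]] := presented_span (of_cop A 1).
(* The scalar coefficients are absorbed into the left factors. *)
exists (size s), (fun i => c (tnth (in_tuple s) i) *: (tnth (in_tuple s) i).1),
  (fun i => (tnth (in_tuple s) i).2).
rewrite e big_tnth; apply: eq_bigr => i _.
case: (tnth _ i) => x y; rewrite -[_ *: x]addr0 pureDl.
by rewrite (bilin0l _ (@pure_bilin _ _ _)) addr0.
Qed.

Lemma word_head_multilin :
  multilin (fun (a : A) s => if s is [::] then handle a else 0).
Proof.
split=> [[|? ?] c a a'|a [|? ?] s2 c x x'|a [|? ?] s2] //;
  rewrite ?scaler0 ?addr0 //.
exact: handle_is_linear.
Qed.

(* The product only sees its left factor through this map to the center. *)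
Definition hoch_handle : C -> A := hlift word_head_multilin.
HB.instance Definition _ :=
  GRing.Linear.copy hoch_handle (hlift word_head_multilin).

Lemma hoch_handle_word a s :
  hoch_handle (word a s) = if s is [::] then handle a else 0.
Proof. exact: hlift_word. Qed.

Lemma hoch_lmul_word (z : A) a s : hoch_lmul z (word a s) = word (z * a) s.
Proof. exact: hlift_word. Qed.

Lemma hoch_lmul_bilin : bilin (@hoch_lmul m A).
Proof. by split=> [y|z]; [exact: hoch_lmul_linear | exact: linearP]. Qed.

Lemma hoch_prodE (x y : C) : hoch_prod x y = hoch_lmul (hoch_handle x) y.
Proof.
move: x y; apply: (@hoch_bilin_eq _ _ (@hoch_prod m A)
  (fun x y => hoch_lmul (hoch_handle x) y)); first exact: hoch_prod_bilin.
  split=> [y|x] k z z'; last exact: linearP.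
  by rewrite linearP; apply: hoch_lmul_linear.
move=> a s c t; rewrite hoch_prod_word hoch_handle_word.
case: s => [|? ?]; first by rewrite hoch_lmul_word.
by symmetry; exact: (bilin0l _ hoch_lmul_bilin).
Qed.

Lemma hoch_handle_central (x : C) (a : A) :
  a * hoch_handle x = hoch_handle x * a.
Proof.
have [N [u [v copE]]] := casimir_exists.
suff /(_ x) : a \*o hoch_handle =1 a \o* hoch_handle by [].
apply: hoch_eq => b s; rewrite /= hoch_handle_word.
by case: s => [|? ?]; rewrite ?mulr0 ?mul0r // (handle_central symA copE).
Qed.

Lemma hoch_handle_d (x : C) : hoch_handle (hoch_d x) = d (hoch_handle x).
Proof.
have [N [u [v copE]]] := casimir_exists.
suff /(_ x) : hoch_handle \o @hoch_d A =1 d \o hoch_handle by [].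
apply: hoch_eq => a s; rewrite /= /hoch_d linearD.
rewrite hoch_dint_word hoch_dext_word hoch_handle_word.
case: s => [|x1 s].
  rewrite sum_apply_cons sum_apply0 sum_merge1 !addr0 linear0 addr0.
  by rewrite /= hoch_handle_word (handle_d symA copE).
rewrite linear0 sum_apply_cons sum_merge_cons !linearD /= !hoch_handle_word.
rewrite /sum_apply /sum_merge !linear_sum big1 => [|i _]; last first.
  by rewrite /= hoch_handle_word; case: (take i _).
rewrite big1 => [|i _]; last first.
  by rewrite /= hoch_handle_word; case: (take i _).
rewrite !add0r addr0; case: s => [|x2 s] /=; last by rewrite addr0.
(* Chains of length one: [handle] takes the same value on the two boundary terms [a0a1] and
   [a1a0]. *)
by rewrite (handleC symA copE) addrr_F2.
Qed.

(** A central [z] can be pulled out of [e' z b e'']. This makes the product associative already on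
    chains. *)
Lemma hoch_handle_lmul (x y : C) :
  hoch_handle (hoch_lmul (hoch_handle x) y) = hoch_handle x * hoch_handle y.
Proof.
have [N [u [v copE]]] := casimir_exists; set z := hoch_handle x.
suff /(_ y) : hoch_handle \o hoch_lmul z =1 z \*o hoch_handle by [].
apply: hoch_eq => b s; rewrite /= hoch_lmul_word !hoch_handle_word.
case: s => [|? ?]; last by rewrite mulr0.
by rewrite (handle_mull symA copE) // => a; apply: hoch_handle_central.
Qed.

Lemma hoch_lmulA (z w : A) (y : C) :
  hoch_lmul z (hoch_lmul w y) = hoch_lmul (z * w) y.
Proof.
suff /(_ y) : hoch_lmul z \o hoch_lmul w =1 hoch_lmul (z * w) by [].
by apply: hoch_eq => a s; rewrite /= !hoch_lmul_word mulrA.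
Qed.

(** Centrality of [z] serves the wrap-around term, where [an] is multiplied from the left onto
    [z a0]. *)
Lemma hoch_lmul_d (z : A) (y : C) : (forall a, a * z = z * a) ->
  hoch_d (hoch_lmul z y) = hoch_lmul (d z) y + hoch_lmul z (hoch_d y).
Proof.
move=> zC.
suff /(_ y) : @hoch_d A \o hoch_lmul z =1
  hoch_lmul (d z) \+ (hoch_lmul z \o @hoch_d A) by [].
apply: hoch_eq => a s; rewrite /= /hoch_d linearD !hoch_lmul_word.
rewrite !hoch_dint_word !sum_apply_cons dga_leibniz.
rewrite (slotD [::] s _ _ (@word_of_slot_linear A)) /= -!addrA; congr (_ + _).
rewrite linearD /= hoch_lmul_word -!addrA; congr (_ + (_ + _)).
  rewrite /sum_apply linear_sum; apply: eq_bigr => i _ /=.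
  by rewrite hoch_lmul_word.
rewrite !hoch_dext_word linearD /=; case: s => [|x s].
  by rewrite !sum_merge1 linear0.
rewrite !sum_merge_cons linearD /= !hoch_lmul_word !mulrA zC; congr (_ + _ + _).
rewrite /sum_merge linear_sum; apply: eq_bigr => i _ /=.
by rewrite hoch_lmul_word.
Qed.

Lemma hoch_prod_d (x y : C) :
  hoch_d (hoch_prod x y) = hoch_prod (hoch_d x) y + hoch_prod x (hoch_d y).
Proof.
rewrite !hoch_prodE hoch_handle_d; apply: hoch_lmul_d => a.
exact: hoch_handle_central.
Qed.

Lemma hoch_prodA (x y w : C) :
  hoch_prod x (hoch_prod y w) = hoch_prod (hoch_prod x y) w.
Proof. by rewrite !hoch_prodE hoch_lmulA hoch_handle_lmul. Qed.

End Product.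

(** * Homotopies *)

Section Homotopies.
Variables (m : int) (A : openFrobenius m) (N : nat) (u v : 'I_N -> A).
Hypothesis symA : symmetric_frobenius A.
Hypothesis copE : of_cop A 1 = \sum_i u i *t v i.
Local Notation C := (hoch A).
Local Notation d := (dga_d A).

(* sum e'a0[a1,...,an,e''b0,b1,...,bq] *)
Definition comm_homotopy : C -> C -> C := block_op u v (word_cat_multilin A).
(* sum_j 1[bj,...,bq,e'a0,a1,...,an,e''b0,b1,...,b(j-1)] *)
Definition rot_homotopy : C -> C -> C := block_op u v (rot_multilin A).
Local Notation K := comm_homotopy.
Local Notation H := rot_homotopy.

Lemma comm_homotopy_bilin : bilin K. Proof. exact: block_op_bilin. Qed.
Lemma rot_homotopy_bilin : bilin H. Proof. exact: block_op_bilin. Qed.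

Lemma comm_homotopy_word a s c t : K (word a s) (word c t) =
  \sum_i word (u i * a) (s ++ v i * c :: t).
Proof.
rewrite [LHS]block_op_word; apply: eq_bigr => i _.
by rewrite /word_cat /= cat_rcons.
Qed.

Lemma bilin_bracket (f : C -> C -> C) : bilin f -> bilin (fun x y =>
  hoch_d (f x y) + (f (hoch_d x) y + f x (hoch_d y))).
Proof.
move=> fb; apply: bilin_add; first exact: (bilin_comp (@hoch_d A) idfun idfun fb).
apply: bilin_add; first exact: (bilin_comp idfun (@hoch_d A) idfun fb).
exact: (bilin_comp idfun idfun (@hoch_d A) fb).
Qed.

Lemma block_op_bracket (F : seq A -> seq A -> C) (Fml : block_multilin F) a s c t :
  block_op u v Fml (hoch_d (word a s)) (word c t)
  + block_op u v Fml (word a s) (hoch_d (word c t)) =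
  \sum_i (sum_apply d (F^~ t) (u i * a :: rcons s (v i * c))
          + sum_apply d (F (u i * a :: rcons s (v i * c))) t)
  + (\sum_i block_merge F (u i * a) (rcons s (v i * c)) t
     + (if s is [::] then F [:: handle a * c] t else 0)).
Proof.
rewrite (block_op_dint copE) (block_op_dext symA copE) addrACA.
have Fb := block_op_bilin u v Fml.
by rewrite (bilinDl _ _ _ Fb) (bilinDr _ _ _ Fb).
Qed.

Lemma addr_cancel_F2 (V : lmodType 'F_2) (x y z w : V) :
  x + (y + z) + (x + (y + w)) = z + w.
Proof. by rewrite addrACA addrr_F2 add0r addrACA addrr_F2 add0r. Qed.

Lemma comm_homotopyP x y :
  hoch_d (K x y) + (K (hoch_d x) y + K x (hoch_d y)) =
  hoch_prod x y + hoch_prod y x.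
Proof.
move: x y; apply: hoch_bilin_eq.
- exact/bilin_bracket/comm_homotopy_bilin.
- apply: bilin_add; first exact: hoch_prod_bilin.
  exact/bilin_flip/hoch_prod_bilin.
move=> a s c t; rewrite block_op_bracket [K _ _]block_op_word linear_sum /=.
under eq_bigr do rewrite /hoch_d hoch_dint_word_cat hoch_dext_word_cat.
rewrite [X in X + _]big_split /= [X in _ + X + _]big_split /=.
(* Internal terms and block merges occur twice and cancel. There remain the collapsed block
   [e'ae''c], present when [s] is empty, and the closed-up block [e''ce'a], present when [t] is
   empty: the two products. *)
rewrite addr_cancel_F2 addrC !hoch_prod_word; congr (_ + _).
case: t => [|y t]; last by rewrite big1.
have fb := slot_bilin c [::] a s (@word_of_slot_linear A).
rewrite (handleE symA copE) (casimir_sym symA copE (mul3_bilin c)) mulr_suml.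
rewrite -[RHS]/(word_of ([::] ++ _ :: s)) (slot_sum _ _ _ (@word_of_slot_linear A)).
by apply: eq_bigr => i _; rewrite /= !mulrA.
Qed.

Lemma rot_homotopyP x y :
  hoch_d (H x y) + (H (hoch_d x) y + H x (hoch_d y)) =
  connes (hoch_prod x y) + (K x y + K y x).
Proof.
move: x y; apply: hoch_bilin_eq.
- exact/bilin_bracket/rot_homotopy_bilin.
- apply: bilin_add.
    exact: (bilin_comp (@connes A) idfun idfun (@hoch_prod_bilin m A)).
  apply: bilin_add; first exact: comm_homotopy_bilin.
  exact/bilin_flip/comm_homotopy_bilin.
move=> a s c t; rewrite block_op_bracket [H _ _]block_op_word linear_sum /=.
under eq_bigr do rewrite /hoch_d hoch_dint_rot hoch_dext_rot.
rewrite [X in X + _]big_split /= [X in _ + X + _]big_split /=.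
(* After the cancellation, the collapsed block gives the Connes operator of the product, and the two
   end terms of [hoch_dext_rot] give the two values of K, the second one after exchanging the
   legs. *)
rewrite addr_cancel_F2 addrC hoch_prod_word; congr (_ + _).
  by case: s => [|? ?]; rewrite ?linear0 // connes_word.
rewrite big_split !comm_homotopy_word; congr (_ + _).
  by apply: eq_bigr => i _; rewrite /word_cat /= cat_rcons.
have fb := slot_bilin c t a s (@word_of_slot_linear A).
rewrite [RHS](casimir_sym symA copE fb); apply: eq_bigr => i _.
by rewrite last_rcons belast_rcons.
Qed.

Lemma comm_homotopy_lmull z x y : (forall a, a * z = z * a) ->
  K (hoch_lmul z x) y = hoch_lmul z (K x y).
Proof.
move=> zC; move: x y; apply: hoch_bilin_eq.
- exact: (bilin_comp idfun (@hoch_lmul m A z) idfun comm_homotopy_bilin).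
- exact: (bilin_comp (@hoch_lmul m A z) idfun idfun comm_homotopy_bilin).
move=> a s c t; rewrite hoch_lmul_word !comm_homotopy_word linear_sum.
by apply: eq_bigr => i _ /=; rewrite hoch_lmul_word !mulrA zC.
Qed.

Lemma comm_homotopy_lmulr z x y : (forall a, a * z = z * a) ->
  K x (hoch_lmul z y) = hoch_lmul z (K x y).
Proof.
move=> zC; move: x y; apply: hoch_bilin_eq.
- exact: (bilin_comp idfun idfun (@hoch_lmul m A z) comm_homotopy_bilin).
- exact: (bilin_comp (@hoch_lmul m A z) idfun idfun comm_homotopy_bilin).
move=> a s c t; rewrite hoch_lmul_word !comm_homotopy_word linear_sum.
have fb := slot_bilin a s c t (@word_of_slot_linear A).
have := casimir_inner symA copE z fb => /= e.
(* [z] passes through [e''] by centrality and then over to [e'] by [casimir_inner]. *)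
transitivity (\sum_i word (u i * z * a) (s ++ v i * c :: t)).
  by rewrite e; apply: eq_bigr => i _; rewrite [v i * _]mulrA zC.
by apply: eq_bigr => i _ /=; rewrite hoch_lmul_word !mulrA zC.
Qed.

Lemma hoch_handle_comm_homotopy x y : hoch_handle (K x y) = 0.
Proof.
pose z (x y : C) : A := 0.
move: x y; apply: (@hoch_bilin_eq _ _ _ z).
- exact: (bilin_comp (@hoch_handle m A) idfun idfun comm_homotopy_bilin).
- by split=> ? ? ? ?; rewrite /z scaler0 addr0.
move=> a s c t; rewrite comm_homotopy_word linear_sum big1 // => i _ /=.
by rewrite hoch_handle_word; case: s.
Qed.

Lemma hoch_handle_connes (x : C) : @hoch_handle m A (connes x) = 0.
Proof.
pose z : {linear C -> A} := \0.
suff /(_ x) : @hoch_handle m A \o @connes A =1 z by [].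
apply: hoch_eq => a s; rewrite /= connes_word /rot /sum_split linear_sum big1 //.
by move=> i _ /=; rewrite hoch_handle_word; case: (drop i s).
Qed.

End Homotopies.

(** * Gradings *)

Section Gradings.
Variables (K : fieldType) (V : lmodType K) (G : int -> {pred V}).
Implicit Types (r : seq (int * V)) (P : pred int).

Lemma submodD (S : {pred V}) x y :
  submod_closed S -> x \in S -> y \in S -> x + y \in S.
Proof. by case=> _ SZD Sx Sy; rewrite -[x]scale1r; apply: SZD. Qed.

Lemma submodZ (S : {pred V}) a x : submod_closed S -> x \in S -> a *: x \in S.
Proof. by case=> S0 SZD Sx; rewrite -[_ *: _]addr0; apply: SZD. Qed.

Lemma submod_sum (S : {pred V}) I (s : seq I) (Q : pred I) (F : I -> V) :
  submod_closed S -> (forall i, Q i -> F i \in S) ->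
  \sum_(i <- s | Q i) F i \in S.
Proof.
move=> Ssub SF; elim/big_ind: _ => //; first exact: Ssub.1.
by move=> x y; apply: submodD.
Qed.

Definition homogeneous r := all (fun x => x.2 \in G x.1) r.

Lemma sum_by_degree P r : \sum_(x <- r | P x.1) x.2 =
  \sum_(k <- undup (unzip1 r) | P k) \sum_(x <- r | x.1 == k) x.2.
Proof.
rewrite (exchange_big_dep xpredT) //= big_mkcond big_seq [RHS]big_seq.
apply: eq_bigr => x xr; case: ifP => Px; last first.
  by rewrite big1 // => k /andP[Pk /eqP xk]; rewrite xk Pk in Px.
rewrite (eq_bigl (pred1 x.1)) => [|k]; last first.
  by rewrite /= eq_sym; case: eqP => [->|]; rewrite ?Px ?andbF.
rewrite -big_filter filter_pred1_uniq ?undup_uniq ?big_seq1 //.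
by rewrite mem_undup map_f.
Qed.

Hypothesis Gsub : forall k, submod_closed (G k).

Lemma sum_degree_mem k r : homogeneous r -> \sum_(x <- r | x.1 == k) x.2 \in G k.
Proof.
move=> /allP hr; rewrite big_seq_cond; apply: submod_sum => // x.
by case/andP=> /hr xG /eqP <-.
Qed.

(** The separating map may depend on the finite set of degrees in play, which allows maps that only
    see degrees modulo a large number. *)
Lemma is_gradingP :
  (forall x, exists2 r, homogeneous r & x = \sum_(y <- r) y.2) ->
  (forall (s : seq int) k, k \in s -> exists h : {linear V -> V},
     forall j x, j \in s -> x \in G j -> h x = if j == k then x else 0) ->
  is_grading G.
Proof.
move=> decV sepV; split=> // [x|s f s_uniq fG sum0 k ks].
  have [r hr ->] := decV x.
  exists (undup (unzip1 r)), (fun k => \sum_(y <- r | y.1 == k) y.2).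
  split=> [k|]; first exact: sum_degree_mem.
  exact: (sum_by_degree xpredT r).
have [h hE] := sepV s k ks; rewrite -(linear0 h) -sum0 linear_sum /=.
rewrite (bigD1_seq k) //= (hE k _ ks (fG k)) eqxx big_seq_cond big1 ?addr0 // => j.
by case/andP=> js jk; rewrite (hE j _ js (fG j)) (negPf jk).
Qed.

Hypothesis Ggr : is_grading G.

Lemma grading_decomp x : exists2 r, homogeneous r & x = \sum_(y <- r) y.2.
Proof.
have [_ /(_ x)[s [f [fG ->]]] _] := Ggr.
exists [seq (k, f k) | k <- s]; last by rewrite big_map.
by apply/allP => _ /mapP[k _ ->] /=.
Qed.

Lemma grading_sum0 P r : homogeneous r -> \sum_(x <- r) x.2 = 0 ->
  \sum_(x <- r | P x.1) x.2 = 0.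
Proof.
move=> hr; rewrite (sum_by_degree xpredT) sum_by_degree => sum0.
have [_ _ /(_ _ _ (undup_uniq _) _ sum0) zero] := Ggr.
rewrite big_seq_cond big1 // => k /andP[kr _].
by apply: zero => // j; apply: sum_degree_mem.
Qed.

Lemma grading_proj P : exists h : {linear V -> V},
  forall k x, x \in G k -> h x = if P k then x else 0.
Proof.
have dec x := cid2 (grading_decomp x).
pose h x := \sum_(y <- s2val (dec x) | P y.1) y.2.
have hE r x : homogeneous r -> x = \sum_(y <- r) y.2 ->
    h x = \sum_(y <- r | P y.1) y.2.
  move=> hr xr; rewrite /h; case: (dec x) => /= t ht xt.
  (* Two decompositions of one element differ by a decomposition of [0], so the selected part does
     not depend on the choice. *)
  pose r' := t ++ [seq (y.1, - y.2) | y <- r].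
  have hr' : homogeneous r'.
    rewrite /homogeneous all_cat all_map; apply/andP; split; first exact: ht.
    apply: sub_all hr => y /= yG.
    by rewrite -scaleN1r; apply: submodZ.
  have := grading_sum0 P hr'; rewrite !big_cat !big_map /= -xt !sumrN -xr subrr.
  by move/(_ erefl)/eqP; rewrite subr_eq0 => /eqP.
have h_lin : linear h.
  move=> a x y; rewrite [h x]/h [h y]/h; case: (dec x) (dec y) => r hr xr [t ht yt] /=.
  rewrite (hE ([seq (z.1, a *: z.2) | z <- r] ++ t)).
  - by rewrite big_cat big_map scaler_sumr.
  - rewrite /homogeneous all_cat all_map; apply/andP; split; last exact: ht.
    apply: sub_all hr => z /= zG.
    exact: submodZ.
  by rewrite big_cat big_map /= -scaler_sumr -xr -yt.
exists (HB.pack_for {linear V -> V} h (GRing.isLinear.Build K V V *:%R h h_lin)).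
move=> k x xG; rewrite /= (hE [:: (k, x)]) ?big_cons ?big_nil ?addr0 //.
by rewrite /homogeneous /= xG.
Qed.

End Gradings.

Lemma is_grading_shift (K : fieldType) (V : lmodType K) (G : int -> {pred V}) m :
  is_grading G -> is_grading (fun k => G (k - m)).
Proof.
case=> Gsub Gdec Gdir; split=> // [x|s f s_uniq fG sum0 k ks].
  have [s [f [fG ->]]] := Gdec x.
  exists [seq k + m | k <- s], (fun k => f (k - m)); split=> //.
  by rewrite big_map; apply: eq_bigr => k _; rewrite addrK.
have := Gdir [seq k - m | k <- s] (fun k => f (k + m)).
rewrite map_inj_uniq // => [/(_ s_uniq)|]; last exact: addIr.
rewrite big_map; under eq_bigr do rewrite subrK.
have fG' j : f (j + m) \in G j by have := fG (j + m); rewrite addrK.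
by move=> /(_ fG' sum0 _ (map_f _ ks)); rewrite subrK.
Qed.

(** * The grading of Hochschild chains *)

Section HochschildGrading.
Variable A : dgAlgebra.
Local Notation C := (hoch A).
Local Notation G := (dga_gr A).
Implicit Types (s t : seq A) (k : int).

Lemma dga_gr_sub k : submod_closed (G k).
Proof. by have [Gsub _ _] := dga_grP A. Qed.

(** A relation and not a function, since the letter [0] lies in every degree. *)
Fixpoint shifted_degree s k : Prop :=
  if s is x :: s' then exists2 q, x \in G q & shifted_degree s' (k - (q - 1))
  else k = 0.

Lemma shifted_degreeP s k : shifted_degree s k <->
  exists2 ps : seq int, \sum_(q <- ps) (q - 1) = k
    & all2 (fun q b => b \in G q) ps s.
Proof.
elim: s k => [|x s IH] k /=.
  split=> [->|[[|//] <- _]]; last by rewrite big_nil.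
  by exists [::]; rewrite ?big_nil.
split=> [[q xq /IH[ps psk ps_s]]|[[|q ps] // <- /andP[xq ps_s]]].
  by exists (q :: ps); rewrite ?big_cons ?psk ?subrKC //= xq.
exists q => //; apply/IH; exists ps => //.
by rewrite big_cons addrC addKr.
Qed.

Lemma shifted_degree_cat s t k l :
  shifted_degree s k -> shifted_degree t l -> shifted_degree (s ++ t) (k + l).
Proof.
elim: s k => [|x s IH] k /= => [-> |[q xq sk] tl]; first by rewrite add0r.
by exists q => //; rewrite addrAC; apply: IH.
Qed.

Lemma shifted_degree_split s t k : shifted_degree (s ++ t) k ->
  exists i j, [/\ k = i + j, shifted_degree s i & shifted_degree t j].
Proof.
elim: s k => [|x s IH] k /=; first by exists 0, k; rewrite add0r.
case=> q xq /IH[i [j [e si tj]]]; exists (i + (q - 1)), j; split=> //.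
  by rewrite addrAC -e subrK.
by exists q => //; rewrite addrK.
Qed.

Lemma hoch_gr_sub k : submod_closed (hoch_gr k : {pred C}).
Proof. exact: span_of_submod. Qed.

(** The [- 1] corrects for the coefficient, which [shifted_degree] lowers like every other letter
    although its degree in a chain is unshifted. *)
Lemma word_gr a s k : shifted_degree (a :: s) (k - 1) -> word a s \in hoch_gr k.
Proof.
case=> p ap /shifted_degreeP[ps psk ps_s]; apply: mem_span_of.
by exists p, a, ps, s; split=> //; lia.
Qed.

Lemma word_of_gr s k : shifted_degree s (k - 1) -> word_of s \in hoch_gr k.
Proof. by case: s => [_|a s]; [apply: (hoch_gr_sub k).1 | apply: word_gr]. Qed.

Lemma hoch_gr_ind k (S : {pred C}) : submod_closed S ->
  (forall a s, shifted_degree (a :: s) (k - 1) -> word a s \in S) ->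
  {subset hoch_gr k <= S}.
Proof.
move=> Ssub Sw x /asboolP[n [c [w [we ->]]]].
apply: submod_sum => // i _; apply: submodZ => //.
have [p [a [ps [s [pk ap ps_s ->]]]]] := we i; apply: Sw; exists p => //.
by apply/shifted_degreeP; exists ps => //; lia.
Qed.

Lemma preim_submod (V W : lmodType 'F_2) (h : {linear V -> W}) (S : {pred W}) :
  submod_closed S -> submod_closed [pred x | h x \in S].
Proof.
case=> S0 SZD; split; rewrite ?inE ?linear0 // => c x y.
by rewrite !inE linearP => hx hy; apply: SZD.
Qed.

(** The offset [e] takes up the degrees of the letters already passed in the induction. *)
Lemma sum_apply_gr (W : lmodType 'F_2) (H : int -> {pred W}) (g : seq A -> W) e s k :
  (forall j, submod_closed (H j)) ->
  (forall t j, shifted_degree t j -> g t \in H (j + e)) ->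
  shifted_degree s k -> sum_apply (dga_d A) g s \in H (k + e + 1).
Proof.
move=> Hsub; elim: s g e k => [|x s IH] g e k gH /=.
  by rewrite sum_apply0 => _; apply: (Hsub _).1.
case=> q xq sk; rewrite sum_apply_cons; apply: submodD => //.
  have -> : k + e + 1 = (k + 1) + e by lia.
  apply: gH; exists (q + 1); first exact: dga_grd.
  by have -> : k + 1 - (q + 1 - 1) = k - (q - 1) by lia.
have -> : k + e + 1 = (k - (q - 1)) + (e + (q - 1)) + 1 by lia.
apply: IH => // t j tj; have -> : j + (e + (q - 1)) = (j + (q - 1)) + e by lia.
by apply: gH; exists q => //; rewrite addrK.
Qed.

Lemma sum_merge_gr (W : lmodType 'F_2) (H : int -> {pred W}) (g : seq A -> W) e s k :
  (forall j, submod_closed (H j)) ->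
  (forall t j, shifted_degree t j -> g t \in H (j + e)) ->
  shifted_degree s k -> sum_merge g s \in H (k + e + 1).
Proof.
move=> Hsub; elim: s g e k => [|x [|y s] IH] g e k gH.
- by rewrite sum_merge0 => _; apply: (Hsub _).1.
- by rewrite sum_merge1 => _; apply: (Hsub _).1.
case=> q xq sk; rewrite sum_merge_cons; apply: submodD => //.
  case: sk => r yr sk; have -> : k + e + 1 = (k + 1) + e by lia.
  apply: gH; exists (q + r); first exact: dga_grM.
  by have -> : k + 1 - (q + r - 1) = k - (q - 1) - (r - 1) by lia.
have -> : k + e + 1 = (k - (q - 1)) + (e + (q - 1)) + 1 by lia.
apply: IH => // t j tj; have -> : j + (e + (q - 1)) = (j + (q - 1)) + e by lia.
by apply: gH; exists q => //; rewrite addrK.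
Qed.

Lemma hoch_d_gr k (x : C) : x \in hoch_gr k -> hoch_d x \in hoch_gr (k + 1).
Proof.
pose S := [pred x : C | @hoch_d A x \in hoch_gr (k + 1)].
have word_of_gr' t j : shifted_degree t j -> word_of t \in hoch_gr (j + 1).
  by move=> tj; apply: word_of_gr; rewrite addrK.
have grE : k + 1 = (k - 1) + 1 + 1 by lia.
apply: (@hoch_gr_ind k S) => [|a s as_k]; first exact/preim_submod/hoch_gr_sub.
rewrite inE /hoch_d hoch_dint_word hoch_dext_word.
apply: submodD; first exact: hoch_gr_sub.
  by rewrite grE; apply: sum_apply_gr => //; apply: hoch_gr_sub.
apply: submodD; first exact: hoch_gr_sub.
  by rewrite grE; apply: sum_merge_gr => //; apply: hoch_gr_sub.
case: s as_k => [|x0 s] [p ap sk]; first exact: (hoch_gr_sub _).1.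
(* The last letter is split off because the wrap-around term moves it to the coefficient. *)
move: (sk : shifted_degree (x0 :: s) _); rewrite lastI -cats1.
case/shifted_degree_split=> [i [j [ij bi [q zq j0]]]].
apply: word_gr; exists (q + p); first exact: dga_grM.
by have -> : k + 1 - 1 - (q + p - 1) = i by lia.
Qed.

Lemma connes_gr k (x : C) : x \in hoch_gr k -> connes x \in hoch_gr (k - 1).
Proof.
pose S := [pred x : C | @connes A x \in hoch_gr (k - 1)].
apply: (@hoch_gr_ind k S) => [|a s [p ap sk]]; first exact/preim_submod/hoch_gr_sub.
rewrite inE connes_word; apply: submod_sum => [|i _]; first exact: hoch_gr_sub.
apply: word_gr; exists 0; first exact: dga_gr1.
move: sk; rewrite -{1}(cat_take_drop i s) => /shifted_degree_split[j [l [jl jt ld]]].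
have -> : k - 1 - 1 - (0 - 1) = l + (j + (p - 1)) by lia.
by apply: shifted_degree_cat => //; exists p => //; rewrite addrK.
Qed.

Section DegreesModulo.
Variable N : nat.

(* Degrees are only separated modulo N.+1, so that the sum over all
   splittings of a degree is finite. *)
Definition residue_proj (r : nat) : {linear A -> A} :=
  sval (cid (grading_proj dga_gr_sub (dga_grP A)
    (fun j => (j == r%:Z %[mod N.+1%:Z])%Z))).

Lemma residue_projE r k x : x \in G k ->
  residue_proj r x = if (k == r%:Z %[mod N.+1%:Z])%Z then x else 0.
Proof. by move=> xk; rewrite /residue_proj; case: cid => h hE; apply: hE. Qed.

(** The part of [g s] of total shifted degree [k] modulo [N.+1], summed over all choices of residues
    for the letters; [k] is the degree still to be distributed. *)
Fixpoint degree_part (W : lmodType 'F_2) (g : seq A -> W) k s : W :=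
  if s is x :: s' then
    \sum_(r < N.+1) degree_part (g \o cons (residue_proj r x)) (k - (r%:Z - 1)) s'
  else if (N.+1%:Z %| k)%Z then g [::] else 0.

Variable W : lmodType 'F_2.
Implicit Type g : seq A -> W.

Lemma degree_part0 g k s : g =1 (fun=> 0) -> degree_part g k s = 0.
Proof.
elim: s g k => [|x s IH] g k g0 /=; first by rewrite g0 if_same.
by rewrite big1 // => r _; apply: IH => t; apply: g0.
Qed.

Lemma degree_part_lin c g g1 g2 k s :
  (forall t, g t = c *: g1 t + g2 t) ->
  degree_part g k s = c *: degree_part g1 k s + degree_part g2 k s.
Proof.
elim: s g g1 g2 k => [|x s IH] g g1 g2 k gE /=.
  by rewrite gE; case: ifP => _ //; rewrite scaler0 addr0.
rewrite scaler_sumr -big_split; apply: eq_bigr => r _ /=.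
by apply: IH => t; apply: gE.
Qed.

Lemma degree_part_linear g k : slot_linear g -> slot_linear (degree_part g k).
Proof.
move=> gl s1; elim: s1 g gl k => [|z s1 IH] g gl k s2 c x y /=;
  rewrite scaler_sumr -big_split; apply: eq_bigr => r _ /=.
  by apply: degree_part_lin => t /=; rewrite linearP; apply: (gl [::]).
exact/IH/slot_linear_cons.
Qed.

Lemma degree_part_normal g k : slot_linear g -> slot_normal g ->
  slot_normal (degree_part g k).
Proof.
move=> gl gn s1; elim: s1 g gl gn k => [|z s1 IH] g gl gn k s2 /=;
  rewrite big1 // => r _.
  (* The unit has degree 0, so each of its residue components is [1] or [0]; normality and linearity
     of [g] dispose of the two cases. *)
  apply: degree_part0 => t /=; rewrite (residue_projE r (dga_gr1 A)).
  by case: ifP => _; [apply: (gn [::]) | apply: (slot0 [::] t gl)].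
by apply: IH; [apply: slot_linear_cons | apply: slot_normal_cons].
Qed.

Lemma degree_part_homogeneous g k j s : slot_linear g -> shifted_degree s j ->
  degree_part g k s = if (k == j %[mod N.+1%:Z])%Z then g s else 0.
Proof.
elim: s g k j => [|x s IH] g k j gl /=.
  by move=> ->; rewrite mod0z -(sameP dvdz_mod0P eqP).
case=> q xq sj.
have ltN : (`|(q %% N.+1%:Z)%Z|%N < N.+1)%N.
  have := ltz_pmod q (isT : 0 < N.+1%:Z).
  by have := modz_ge0 q (isT : N.+1%:Z != 0); lia.
have qE : (Ordinal ltN)%:Z = (q %% N.+1%:Z)%Z.
  by rewrite /= gez0_abs //; apply: modz_ge0.
rewrite (bigD1 (Ordinal ltN)) //= big1 => [|r rq].
  rewrite addr0 (residue_projE _ xq) qE modz_mod eqxx.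
  rewrite (IH _ _ _ (slot_linear_cons x gl) sj) /=; congr (if _ then _ else _).
  rewrite !eqz_mod_dvd.
  have -> : k - ((q %% N.+1%:Z)%Z - 1) - (j - (q - 1)) =
    (k - j) + (q %/ N.+1%:Z)%Z * N.+1%:Z.
    by rewrite [X in _ - (j - (X - 1))](divz_eq q N.+1%:Z); lia.
  by rewrite rpredDr // dvdz_mull.
apply: degree_part0 => t /=; rewrite (residue_projE _ xq).
case: eqP => [qr|_]; last exact: (slot0 [::] t gl).
case/eqP: rq; apply: val_inj => /=; rewrite qr modz_small //.
by have := ltn_ord r; lia.
Qed.

End DegreesModulo.

Lemma hoch_degree_multilin N k : multilin (fun a (s : seq A) =>
  degree_part N (@word_of A) (k - 1) (a :: s)).
Proof.
have wl := @word_of_slot_linear A.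
split=> [s|a s1 s2|a s1 s2].
- exact: (degree_part_linear N (k - 1) wl [::] s).
- exact: (degree_part_linear N (k - 1) wl (a :: s1) s2).
rewrite /= big1 // => r _; apply: degree_part_normal.
  exact: slot_linear_cons.
by move=> t1 t2; apply: word1.
Qed.

Lemma hoch_gr_sep N k : exists h : {linear C -> C}, forall j x,
  x \in hoch_gr j -> h x = if (k == j %[mod N.+1%:Z])%Z then x else 0.
Proof.
exists (hlift (hoch_degree_multilin N k) : {linear C -> C}) => j.
pose h' : {linear C -> C} :=
  if (k == j %[mod N.+1%:Z])%Z then (idfun : {linear C -> C})
  else (\0 : {linear C -> C}).
pose S := [pred x : C | hlift (hoch_degree_multilin N k) x == h' x].
suff SP : {subset hoch_gr j <= S}.
  by move=> x /SP/eqP /= ->; rewrite /h'; case: ifP.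
apply: hoch_gr_ind => [|a s as_j].
  split=> [|c x y]; rewrite !inE ?linear0 // => /eqP hx /eqP hy.
  by rewrite !linearP /= hx hy.
rewrite inE hlift_word (degree_part_homogeneous N _ (@word_of_slot_linear A) as_j).
by rewrite eqz_modDr /h'; case: ifP.
Qed.

(** Each letter in turn is replaced by its homogeneous components, and linearity in that slot
    reduces the claim to words with homogeneous letters. *)
Lemma slot_decomp (g : seq A -> C) (P : C -> Prop) : P 0 ->
  (forall x y, P x -> P y -> P (x + y)) -> slot_linear g ->
  (forall s k, shifted_degree s k -> P (g s)) -> forall s, P (g s).
Proof.
move=> P0 PD gl Pg s; elim: s g gl Pg => [|x s IH] g gl Pg; first exact: (Pg _ 0).
have [r hr ->] := grading_decomp (dga_grP A) x.
elim: r hr => [_|[q y] r IHr /andP[/= yq hr]].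
  by rewrite big_nil (slot0 [::] s gl).
rewrite big_cons (slotD [::] s y _ gl); apply: PD; last exact: IHr.
apply: (IH (g \o cons y)) => [|t k tk]; first exact: slot_linear_cons.
by apply: (Pg _ (k + (q - 1))); exists q => //; rewrite addrK.
Qed.

Lemma hoch_decomp (x : C) :
  exists2 r, homogeneous (@hoch_gr A) r & x = \sum_(y <- r) y.2.
Proof.
pose P (x : C) := exists2 r, homogeneous (@hoch_gr A) r & x = \sum_(y <- r) y.2.
have P0 : P 0 by exists [::]; rewrite ?big_nil.
have PD y z : P y -> P z -> P (y + z).
  move=> [r hr ->] [t ht ->]; exists (r ++ t); last by rewrite big_cat.
  by rewrite /homogeneous all_cat; apply/andP; split; [apply: hr | apply: ht].
have PZ c y : P y -> P (c *: y).
  move=> [r hr ->]; exists [seq (z.1, c *: z.2) | z <- r].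
    rewrite /homogeneous all_map; apply: sub_all hr => z /= zG.
    exact/submodZ/zG/hoch_gr_sub.
  by rewrite big_map scaler_sumr.
have [s [c ->]] := presented_span x; elim/big_rec: _ => // -[a t] y _ Py.
apply: (PD) => //; apply: PZ.
apply: (slot_decomp P0 PD (@word_of_slot_linear A)) (a :: t) => t' k tk.
exists [:: (k + 1, word_of t')]; last by rewrite big_seq1.
by rewrite /homogeneous /= word_of_gr // addrK.
Qed.

Lemma abs_le_sum (s : seq int) k : k \in s ->
  (`|k|%N <= \sum_(j <- s) `|j|%N)%N.
Proof. by move=> ks; rewrite (big_rem k) //= leq_addr. Qed.

Lemma hoch_is_grading : is_grading (@hoch_gr A).
Proof.
apply: is_gradingP; [exact: hoch_gr_sub | exact: hoch_decomp | move=> s k ks].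
pose M := (\sum_(j <- s) `|j|%N)%N.
(* Two degrees in [s] differ by at most [2 * M], so modulo [2 * M + 1] they are congruent only if
   equal. *)
have [h hE] := hoch_gr_sep (2 * M) k; exists h => j x js xj.
rewrite (hE j x xj); congr (if _ then _ else _).
apply/idP/eqP => [|->]; last exact: eqxx.
rewrite eqz_mod_dvd => /dvdzP[q kj].
have := abs_le_sum ks; have := abs_le_sum js; rewrite -/M => jM kM.
have [q0|q0] := eqVneq q 0; first by move: kj; rewrite q0 mul0r; lia.
have : (`|(q * (2 * M).+1%:Z)%R|%N < (2 * M).+1)%N by rewrite -kj; lia.
by rewrite abszM absz_nat -[X in (_ < X)%N]mul1n ltn_mul2r /=; lia.
Qed.

End HochschildGrading.

(** * The product raises degrees by m *)

Section ProductDegree.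
Variables (m : int) (A : openFrobenius m).
Local Notation C := (hoch A).

Lemma handle_gr k (a : A) : a \in dga_gr A k -> handle a \in dga_gr A (k + m).
Proof.
move=> /of_copgr/asboolP[n [c [w [we e]]]]; rewrite /handle e linear_sum.
apply: submod_sum => [|i _]; first exact: dga_gr_sub.
have [p [q [x [y [<- xp yq ->]]]]] := we i; rewrite linearZ /= tlift_pure.
apply: submodZ; first exact: dga_gr_sub.
by rewrite addrC; apply: dga_grM.
Qed.

Lemma hoch_handle_gr k (x : C) :
  x \in hoch_gr k -> hoch_handle x \in dga_gr A (k + m).
Proof.
pose S := [pred x : C | @hoch_handle m A x \in dga_gr A (k + m)].
apply: (@hoch_gr_ind _ k S) => [|a s [p ap sk]].
  exact/preim_submod/dga_gr_sub.
rewrite inE hoch_handle_word; case: s sk => [e|? ? _].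
  by apply: handle_gr; rewrite (_ : k = p) //; move: e => /=; lia.
exact: (dga_gr_sub A _).1.
Qed.

Lemma hoch_lmul_gr (z : A) k l (y : C) :
  z \in dga_gr A l -> y \in hoch_gr k -> hoch_lmul z y \in hoch_gr (l + k).
Proof.
move=> zl.
pose S := [pred y : C | @hoch_lmul m A z y \in hoch_gr (l + k)].
apply: (@hoch_gr_ind _ k S) => [|a s [p ap sk]].
  exact/preim_submod/hoch_gr_sub.
rewrite inE hoch_lmul_word; apply: word_gr; exists (l + p); first exact: dga_grM.
by have -> : l + k - 1 - (l + p - 1) = k - 1 - (p - 1) by lia.
Qed.

Lemma hoch_prod_gr k l (x y : C) : x \in hoch_gr k -> y \in hoch_gr l ->
  hoch_prod x y \in hoch_gr (k + l + m).
Proof.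
move=> /hoch_handle_gr xk yl; rewrite hoch_prodE addrAC.
exact: hoch_lmul_gr.
Qed.

End ProductDegree.

(** * Hochschild homology *)

Lemma oppr_F2 (V : lmodType 'F_2) (x : V) : - x = x.
Proof. by apply/eqP; rewrite -subr_eq0 -opprD oppr_eq0 addrr_F2. Qed.

Section Homology.
Variable A : dgAlgebra.
Local Notation C := (hoch A).
Implicit Types (x y : C) (z w : cycles A).

Lemma cycle_d z : hoch_d (val z) = 0.
Proof. exact/eqP/(valP z). Qed.

Lemma HHclass_surj (h : HH A) : exists z, HHclass A z = h.
Proof. exact: quot_class_surj. Qed.

Lemma HHclass_eq0 z : HHclass A z = 0 <-> exists x, val z = hoch_d x.
Proof.
split=> [/eqP|zx]; last apply/eqP; rewrite quot_class_eq0; last exact/asboolP.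
by move/asboolP.
Qed.

Lemma HHclass_eq z w :
  HHclass A z = HHclass A w <-> exists x, val z + val w = hoch_d x.
Proof.
have -> : val z + val w = val (z - w) by rewrite raddfB /= oppr_F2.
rewrite -HHclass_eq0 linearB; split=> [-> | /eqP]; first exact: subrr.
by rewrite subr_eq0 => /eqP.
Qed.

(** Outside the cycles the value is the zero cycle; [mk_cycleK] is the case that matters. *)
Definition mk_cycle x : cycles A := insubd 0 x.

Lemma mk_cycleK x : hoch_d x = 0 -> val (mk_cycle x) = x.
Proof. by move=> dx; rewrite val_insubd inE dx eqxx. Qed.

Definition HHrep (h : HH A) : cycles A := sval (cid (HHclass_surj h)).

Lemma HHrepK h : HHclass A (HHrep h) = h.
Proof. by rewrite /HHrep; case: cid. Qed.

Lemma HHrep_class z : exists x, val (HHrep (HHclass A z)) + val z = hoch_d x.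
Proof. by apply/HHclass_eq; rewrite HHrepK. Qed.

Lemma HH_gr_sub k : submod_closed (HH_gr A k).
Proof.
split=> [|c h1 h2 /asboolP[z zk <-] /asboolP[w wk <-]]; apply/asboolP.
  exists 0; last exact: linear0.
  by rewrite raddf0; apply: (hoch_gr_sub A k).1.
exists (c *: z + w); last exact: linearP.
by rewrite linearP; apply: (hoch_gr_sub A k).2.
Qed.

Lemma HH_is_grading : is_grading (HH_gr A).
Proof.
have Csub := @hoch_gr_sub A.
split=> [|h|s f s_uniq fG sum0 k ks]; first exact: HH_gr_sub.
  have [z <-] := HHclass_surj h; have [r hr zr] := hoch_decomp (val z).
  pose f k := \sum_(y <- r | y.1 == k) y.2.
  have fk k : f k \in hoch_gr k by apply: sum_degree_mem.
  pose s := undup (unzip1 r); have zf : val z = \sum_(k <- s) f k.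
    by rewrite zr (sum_by_degree xpredT).
  (* The shape [k - -1] fits [is_grading_shift] at [-1]. As the boundaries of the components sum to
     zero in distinct degrees, each component of a cycle is a cycle. *)
  have df k : hoch_d (f k) \in hoch_gr (k - -1).
    by rewrite opprK; apply: hoch_d_gr.
  have [_ _ /(_ s (fun k => hoch_d (f k)) (undup_uniq _) df)] :=
    is_grading_shift (-1) (hoch_is_grading A).
  have sum_d : \sum_(k <- s) hoch_d (f k) = 0.
    by rewrite -linear_sum -zf; exact: cycle_d.
  move=> /(_ sum_d) df0.
  have fs0 k : k \notin s -> f k = 0.
    move=> ks; rewrite /f big_seq_cond big1 // => y /andP[yr /eqP yk].
    by rewrite mem_undup -yk map_f in ks.
  have {}df0 k : hoch_d (f k) = 0.
    by have [/df0 //|/fs0 ->] := boolP (k \in s); rewrite linear0.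
  exists s, (fun k => HHclass A (mk_cycle (f k))); split=> [k|].
    by apply/asboolP; exists (mk_cycle (f k)); rewrite ?mk_cycleK.
  rewrite -linear_sum; congr (HHclass A _); apply: val_inj.
  by rewrite linear_sum zf; apply: eq_bigr => k _ /=; rewrite mk_cycleK.
have fz j : {z | val z \in hoch_gr j & HHclass A z = f j}.
  by apply: cid2; apply/asboolP; apply: fG.
pose g j := s2val (fz j).
have gk j : val (g j) \in hoch_gr j by rewrite /g; case: (fz j).
have gf j : HHclass A (g j) = f j by rewrite /g; case: (fz j).
have /HHclass_eq0[x gx] : HHclass A (\sum_(j <- s) g j) = 0.
  by rewrite linear_sum -[RHS]sum0; apply: eq_bigr => j _; apply: gf.
have [h hE] := grading_proj Csub (hoch_is_grading A) (pred1 k).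
rewrite -gf; apply/HHclass_eq0; have [r /allP hr xr] := hoch_decomp x.
(* Since [hoch_d] has degree 1, the degree [k] component of the boundary of [x] is the boundary of
   the component of degree [k - 1]. *)
exists (\sum_(y <- r | y.1 + 1 == k) y.2).
have -> : val (g k) = h (val (\sum_(j <- s) g j)).
  rewrite 2!linear_sum (bigD1_seq k) //= (hE k) ?gk //= eqxx.
  rewrite big1 ?addr0 // => j jk.
  by rewrite (hE j) ?gk //= (negPf jk).
rewrite gx xr !linear_sum [RHS]big_mkcond; apply: eq_big_seq => y yr /=.
by rewrite (hE (y.1 + 1)) //; apply/hoch_d_gr/hr.
Qed.

End Homology.

(** * The BV-structure on Hochschild homology *)

Section BVStructure.
Variables (m : int) (A : openFrobenius m).
Hypothesis symA : symmetric_frobenius A.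
Local Notation C := (hoch A).
Implicit Types (x y w : C) (z : cycles A).

Lemma hoch_prod_cycle x y :
  hoch_d x = 0 -> hoch_d y = 0 -> hoch_d (hoch_prod x y) = 0.
Proof.
move=> dx dy; rewrite hoch_prod_d // dx dy.
rewrite (bilin0l _ (hoch_prod_bilin A)) (bilin0r _ (hoch_prod_bilin A)).
exact: addr0.
Qed.

Lemma connes_cycle x : hoch_d x = 0 -> hoch_d (connes x) = 0.
Proof. by move=> dx; rewrite -connes_d dx linear0. Qed.

Lemma hoch_prod_comm x y : hoch_d x = 0 -> hoch_d y = 0 ->
  exists w, hoch_prod x y + hoch_prod y x = hoch_d w.
Proof.
move=> dx dy; have [N [u [v copE]]] := casimir_exists A.
exists (comm_homotopy u v x y); rewrite -(comm_homotopyP symA copE) dx dy.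
rewrite (bilin0l _ (comm_homotopy_bilin u v)) (bilin0r _ (comm_homotopy_bilin u v)).
by rewrite !addr0.
Qed.

Lemma hoch_prod_connesl x y : hoch_prod (connes x) y = 0 :> C.
Proof.
rewrite hoch_prodE hoch_handle_connes.
exact: (bilin0l _ (@hoch_lmul_bilin m A)).
Qed.

Lemma connes_prod3 x y w : hoch_d x = 0 -> hoch_d y = 0 -> hoch_d w = 0 ->
  exists b, connes (hoch_prod (hoch_prod x y) w) = hoch_d b.
Proof.
move=> dx dy dw; have [N [u [v copE]]] := casimir_exists A.
pose K := comm_homotopy u v; pose H := rot_homotopy u v.
have Kb : bilin K := comm_homotopy_bilin u v.
have Hb : bilin H := rot_homotopy_bilin u v.
pose k := K y w + K w y.
(* Both summands of [k] have the boundary [y o w + w o y]. *)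
have dk : hoch_d k = 0.
  have := comm_homotopyP symA copE y w; have := comm_homotopyP symA copE w y.
  rewrite -/K dy dw !(bilin0l _ Kb) !(bilin0r _ Kb) !addr0 linearD /= => -> ->.
  by rewrite [X in _ + X]addrC addrr_F2.
have kx0 : hoch_prod k x = 0.
  rewrite hoch_prodE linearD /= !hoch_handle_comm_homotopy addr0.
  exact: (bilin0l _ (@hoch_lmul_bilin m A)).
set z := hoch_handle x; have zC : forall a, a * z = z * a.
  exact: hoch_handle_central.
have dzw : hoch_d (hoch_lmul z w) = 0.
  by have := hoch_prod_cycle dx dw; rewrite hoch_prodE.
have -> : hoch_prod (hoch_prod x y) w = hoch_prod y (hoch_lmul z w).
  rewrite -hoch_prodA // !hoch_prodE -/z !hoch_lmulA.
  by congr (hoch_lmul _ _); rewrite zC.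
(* The first term bounds the Connes operator of the product plus [z k]; the second bounds
   [x o k + k o x], which is [z k] because [k o x = 0]. *)
exists (H y (hoch_lmul z w) + K x k); rewrite linearD /=.
have := rot_homotopyP symA copE y (hoch_lmul z w).
rewrite -/H -/K dy dzw (bilin0l _ Hb) (bilin0r _ Hb) !addr0 => ->.
have := comm_homotopyP symA copE x k.
rewrite -/K dx dk (bilin0l _ Kb) (bilin0r _ Kb) !addr0 kx0 addr0 => ->.
rewrite /K comm_homotopy_lmulr // comm_homotopy_lmull // -/K.
rewrite [hoch_prod x k]hoch_prodE -/z /k [hoch_lmul z (_ + _)]linearD /=.
by rewrite -addrA addrr_F2 addr0.
Qed.

Definition HHmul (h1 h2 : HH A) : HH A :=
  HHclass A (mk_cycle (hoch_prod (val (HHrep h1)) (val (HHrep h2)))).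

Definition HHconnes (h : HH A) : HH A :=
  HHclass A (mk_cycle (connes (val (HHrep h)))).

Lemma HHmul_class z1 z2 : HHmul (HHclass A z1) (HHclass A z2) =
  HHclass A (mk_cycle (hoch_prod (val z1) (val z2))).
Proof.
have pb := hoch_prod_bilin A.
apply/HHclass_eq; have [x1 e1] := HHrep_class z1; have [x2 e2] := HHrep_class z2.
rewrite !mk_cycleK; try by apply: hoch_prod_cycle; apply: cycle_d.
(* The representatives are exchanged one at a time, first in the left factor and then in the right
   one. *)
exists (hoch_prod x1 (val (HHrep (HHclass A z2))) + hoch_prod (val z1) x2).
rewrite linearD /= !hoch_prod_d // !cycle_d (bilin0r _ pb) (bilin0l _ pb).
rewrite addr0 add0r -e1 -e2 (bilinDl _ _ _ pb) (bilinDr _ _ _ pb) -addrA.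
by congr (_ + _); rewrite addrA addrr_F2 add0r.
Qed.

Lemma HHconnes_class z :
  HHconnes (HHclass A z) = HHclass A (mk_cycle (connes (val z))).
Proof.
apply/HHclass_eq; have [x e] := HHrep_class z.
rewrite !mk_cycleK; try by apply: connes_cycle; apply: cycle_d.
by exists (connes x); rewrite -connes_d -e linearD.
Qed.

Lemma mk_cycle_eq x y : hoch_d x = 0 -> hoch_d y = 0 ->
  (exists w, x + y = hoch_d w) ->
  HHclass A (mk_cycle x) = HHclass A (mk_cycle y).
Proof. by move=> dx dy [w e]; apply/HHclass_eq; exists w; rewrite !mk_cycleK. Qed.

Lemma mk_cycleP c x y : hoch_d x = 0 -> hoch_d y = 0 ->
  HHclass A (mk_cycle (c *: x + y)) =
  c *: HHclass A (mk_cycle x) + HHclass A (mk_cycle y).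
Proof.
move=> dx dy; rewrite -linearP; congr (HHclass A _); apply: val_inj.
by rewrite linearP /= !mk_cycleK // linearP /= dx dy scaler0 addr0.
Qed.

Lemma HHmul_bilin : bilin HHmul.
Proof.
have [pl pr] := hoch_prod_bilin A.
split=> [h|h] c h1 h2; have [z <-] := HHclass_surj h;
  have [z1 <-] := HHclass_surj h1; have [z2 <-] := HHclass_surj h2;
  rewrite -linearP !HHmul_class -mk_cycleP ?linearP /= ?pl ?pr //;
  by apply: hoch_prod_cycle; apply: cycle_d.
Qed.

Lemma HHconnes_linear : linear HHconnes.
Proof.
move=> c h1 h2; have [z1 <-] := HHclass_surj h1; have [z2 <-] := HHclass_surj h2.
rewrite -linearP !HHconnes_class -mk_cycleP ?linearP //;
  by apply: connes_cycle; apply: cycle_d.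
Qed.

Lemma HHmulC : commutative HHmul.
Proof.
move=> h1 h2; have [z1 <-] := HHclass_surj h1; have [z2 <-] := HHclass_surj h2.
rewrite !HHmul_class; apply: mk_cycle_eq;
  by [apply: hoch_prod_cycle; apply: cycle_d | apply: hoch_prod_comm; apply: cycle_d].
Qed.

Lemma HHmulA : associative HHmul.
Proof.
move=> h1 h2 h3; have [z1 <-] := HHclass_surj h1.
have [z2 <-] := HHclass_surj h2; have [z3 <-] := HHclass_surj h3.
rewrite !HHmul_class !mk_cycleK ?hoch_prodA //;
  by apply: hoch_prod_cycle; apply: cycle_d.
Qed.

Lemma HHmul_connesl h1 h2 : HHmul (HHconnes h1) h2 = 0.
Proof.
have [z1 <-] := HHclass_surj h1; have [z2 <-] := HHclass_surj h2.
rewrite HHconnes_class HHmul_class mk_cycleK; last exact/connes_cycle/cycle_d.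
rewrite hoch_prod_connesl; apply/HHclass_eq0; exists 0.
by rewrite mk_cycleK linear0.
Qed.

Lemma HHmul_connesr h1 h2 : HHmul h1 (HHconnes h2) = 0.
Proof. by rewrite HHmulC HHmul_connesl. Qed.

Lemma HHconnes_mul3 h1 h2 h3 : HHconnes (HHmul (HHmul h1 h2) h3) = 0.
Proof.
have [z1 <-] := HHclass_surj h1; have [z2 <-] := HHclass_surj h2.
have [z3 <-] := HHclass_surj h3.
have [d1 d2 d3] := And3 (cycle_d z1) (cycle_d z2) (cycle_d z3).
have d12 := hoch_prod_cycle d1 d2; have d123 := hoch_prod_cycle d12 d3.
rewrite !HHmul_class HHconnes_class !mk_cycleK //.
have [b e] := connes_prod3 d1 d2 d3.
by apply/HHclass_eq0; exists b; rewrite mk_cycleK //; apply: connes_cycle.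
Qed.

Lemma HH_BV_algebra :
  BV_algebra (fun k : int => HH_gr A (k - m)) (-1) HHmul HHconnes.
Proof.
split.
- exact/is_grading_shift/HH_is_grading.
- exact: HHmul_bilin.
- move=> p q h1 h2 /asboolP[z1 p1 <-] /asboolP[z2 q2 <-].
  rewrite HHmul_class; apply/asboolP; eexists; last by [].
  rewrite mk_cycleK; last by apply: hoch_prod_cycle; apply: cycle_d.
  (* Before the shift the product has degree [m]; indexing by [k - m] makes it degree 0. *)
  have -> : p + q - m = (p - m) + (q - m) + m by lia.
  exact: hoch_prod_gr.
- exact: HHmulA.
- exact: HHmulC.
- exact: HHconnes_linear.
- by right.
- move=> p h /asboolP[z pz <-]; rewrite HHconnes_class; apply/asboolP.
  eexists; last by []; rewrite mk_cycleK; last exact/connes_cycle/cycle_d.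
  by rewrite addrAC; apply: connes_gr.
- move=> h; have [z <-] := HHclass_surj h; rewrite !HHconnes_class.
  rewrite mk_cycleK; last exact/connes_cycle/cycle_d.
  by rewrite connes_connes; apply/HHclass_eq0; exists 0; rewrite mk_cycleK linear0.
move=> a b c.
have mul0l h : HHmul 0 h = 0 := bilin0l h HHmul_bilin.
(* The seven-term relation holds because each of its seven terms is zero. *)
by rewrite HHconnes_mul3 !HHmul_connesl !HHmul_connesr !mul0l !addr0.
Qed.

End BVStructure.

Theorem theorem5p6 (m : int) (A : openFrobenius m)
    (symA : symmetric_frobenius A) :
  exists (mul : HH A -> HH A -> HH A) (Delta : HH A -> HH A),
  [/\ BV_algebra (fun k : int => HH_gr A (k - m)) (-1) mul Delta,
      forall x : cycles A, exists2 z : cycles A,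
        val z = connes (val x) & Delta (HHclass A x) = HHclass A z
    & forall x y : cycles A, exists2 z : cycles A,
        val z = hoch_prod (val x) (val y) &
        mul (HHclass A x) (HHclass A y) = HHclass A z].
Proof.
exists (@HHmul m A), (@HHconnes m A); split; first exact: HH_BV_algebra.
  move=> x; exists (mk_cycle (connes (val x))); last exact: HHconnes_class.
  exact/mk_cycleK/connes_cycle/cycle_d.
move=> x y; exists (mk_cycle (hoch_prod (val x) (val y))).
  by apply: mk_cycleK; apply: hoch_prod_cycle => //; apply: cycle_d.
exact: HHmul_class.
Qed.
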